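(* Let $p\in[1,\infty]$ and let $H:\ell^p(\mathbb{Z})\to\ell^p(\mathbb{Z})$ be given by $(Hx)_n=x_{n+1}+x_{n-1}+v(n)x_n$, $n\in\mathbb{Z}$, where $v:\mathbb{Z}\to\mathbb{R}$ is periodic with period $K\in\mathbb{N}$ (i.e. $v(n+K)=v(n)$ for all $n$). Set \[ M:=\begin{pmatrix}-v(K-1)&-1\\1&0\end{pmatrix}\cdots\begin{pmatrix}-v(1)&-1\\1&0\end{pmatrix}\begin{pmatrix}-v(0)&-1\\1&0\end{pmatrix}. \] If one of the following three assumptions is satisfied: (a) $K=2$ and $v(n)\in\mathbb{R}$ for all $n\in\mathbb{Z}$; (b) $K\leq 8$ and $v(n)\in\{0,\lambda\}$ for all $n\in\mathbb{Z}$ for a fixed rational number $\lambda\in\mathbb{Q}$; (c) $K\in\mathbb{N}$ and $v(n)\in\mathbb{Z}$ for all $n\in\mathbb{Z}$; then the finite section method for $H$ is applicable if and only if $|\operatorname{tr}(M)|>2$.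
   Context: Finite section method (FSM): for a bounded operator $A$ on $\ell^p(\mathbb{Z})$ with matrix $(a_{ij})_{i,j\in\mathbb{Z}}$ w.r.t. the canonical basis, let $A_n=(a_{ij})_{i,j=-n}^n$; the FSM for $A$ is called applicable if $A$ is invertible, the matrices $A_n$ are invertible for all sufficiently large $n$, and their inverses (embedded into two-sided infinite matrices) converge strongly to $A^{-1}$.
   Formalization: For p=∞ strong convergence of the inverses always fails (e.g. on a constant sequence), so there it is replaced by P-convergence: ‖P_k(A_n^{-1}-A^{-1})‖→0 and ‖(A_n^{-1}-A^{-1})P_k‖→0 for every k; sequences in ℓ^p(Z) are real-valued. *)

(* Defs.v *)
From HB Require Import structures.
From mathcomp Require Import all_boot all_order all_algebra.
From mathcomp Require Import all_classical all_reals all_analysis.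

Set Implicit Arguments.
Unset Strict Implicit.
Unset Printing Implicit Defensive.

Import Order.TTheory GRing.Theory Num.Theory.
Local Open Scope classical_set_scope.
Local Open Scope ring_scope.

Section Defs.
Variable R : realType.

Definition lpnorm (p : \bar R) (x : int -> R) : \bar R :=
  match p with
  | r%:E => poweR (\esum_(n in [set: int]) ((`|x n| `^ r)%:E)) r^-1
  | _ => ereal_sup (range (fun n : int => (`|x n|)%:E))
  end.

Definition in_lp (p : \bar R) (x : int -> R) : Prop := (lpnorm p x < +oo)%E.

Definition fsection (a : int -> int -> R) (n : nat) : 'M[R]_(n.*2.+1) :=
  \matrix_(i < n.*2.+1, j < n.*2.+1) a (i%:Z - n%:Z) (j%:Z - n%:Z).

(** The inverse of A_n, embedded into a two-sided infinite matrix
    (zero outside [-n,n]^2), applied to a sequence x. *)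
Definition fsection_inv (a : int -> int -> R) (n : nat) (x : int -> R)
  : int -> R := fun i =>
  if (- n%:Z <= i <= n%:Z) then
    \sum_(j < n.*2.+1)
       invmx (fsection a n) (inord (absz (i + n%:Z))) j * x (j%:Z - n%:Z)
  else 0.

Definition Pk (k : nat) (x : int -> R) : int -> R :=
  fun i => if (absz i <= k)%N then x i else 0.

Definition opnorm_inf (T : (int -> R) -> (int -> R)) : \bar R :=
  ereal_sup [set lpnorm +oo%E (T x) | x in [set x | (lpnorm +oo%E x <= 1)%E]].

Definition lp_inverse (p : \bar R) (A Ainv : (int -> R) -> (int -> R)) : Prop :=
  forall x, in_lp p x ->
    [/\ in_lp p (Ainv x), A (Ainv x) = x & Ainv (A x) = x].

(** Convergence of B_n to B: strong convergence for p < oo;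
    for p = oo, P-strong convergence. *)
Definition fsm_conv (p : \bar R) (B : nat -> (int -> R) -> (int -> R))
  (Binf : (int -> R) -> (int -> R)) : Prop :=
  if p is +oo%E then
    forall k : nat,
      ((fun n => opnorm_inf (fun x => Pk k (B n x \- Binf x))) @ \oo --> 0%E) /\
      ((fun n => opnorm_inf (fun x => B n (Pk k x) \- Binf (Pk k x))) @ \oo --> 0%E)
  else
    forall x, in_lp p x ->
      (fun n => lpnorm p (B n x \- Binf x)) @ \oo --> 0%E.

Definition FSM_applicable (p : \bar R) (a : int -> int -> R)
  (A : (int -> R) -> (int -> R)) : Prop :=
  exists Ainv, lp_inverse p A Ainv /\
    (\forall n \near \oo, fsection a n \in unitmx) /\
    fsm_conv p (fsection_inv a) Ainv.

Definition schrod (v : int -> R) (x : int -> R) : int -> R :=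
  fun n => x (n + 1) + x (n - 1) + v n * x n.

Definition schrod_mx (v : int -> R) (i j : int) : R :=
  if (j == i + 1) || (j == i - 1) then 1 else if j == i then v i else 0.

Definition tmx (c : R) : 'M[R]_2 :=
  \matrix_(i < 2, j < 2)
    (if (i == 0%N :> nat) then (if (j == 0%N :> nat) then - c else -1)
     else (if (j == 0%N :> nat) then 1 else 0)).

Definition monodromy (v : int -> R) (K : nat) : 'M[R]_2 :=
  \prod_(i < K) tmx (v (K.-1 - i)%N%:Z).

End Defs.

(* Main.v *)
Require Import Defs.
From HB Require Import structures.
From mathcomp Require Import all_boot all_order all_algebra.
From mathcomp Require Import all_classical all_reals all_analysis.
From mathcomp Require Import zify ring lra.
Import Order.TTheory GRing.Theory Num.Theory.
Import numFieldNormedType.Exports.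
Local Open Scope classical_set_scope.
Local Open Scope ring_scope.

(** Let [t] be the trace of the monodromy matrix.  Every solution of [H x = 0]
    satisfies [x (n + 2K) = t * x (n + K) - x n].  If [|t| <= 2] this recurrence
    has no nonzero decaying solution, so [H y = delta_0] is not solvable in l^p
    for finite [p], and it has a nonzero bounded solution on the whole line, so
    [H] is not injective on l^oo.

    If [|t| > 2] there are solutions [e] and [f] decaying exponentially at
    [+oo] and [-oo], each multiplied by a constant [nu], [nu^2 <> 1], when
    shifted by a period.  A zero of one of them would recur one period later;
    the arithmetic assumptions then force [nu = 1] or [nu = -1].  So [e] and [f]
    vanish nowhere, and the combinations [phi] of them vanishing at [-(n+1)]
    and [psi] vanishing at [n+1] stay close to [f] and [e].  The Green kernel
    built from [phi] and [psi] is the inverse of the n-th finite section; it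
    differs from the Green kernel of [H], built from [f] and [e], by an amount
    exponentially small away from the two ends. *)

Set Implicit Arguments.
Unset Strict Implicit.
Unset Printing Implicit Defensive.

(** * Solutions of the periodic equation *)

Section Solutions.
Context {R : realType}.
Implicit Types (v w x y : int -> R) (n j : int).

Definition solution v x := forall n, schrod v x n = 0.

Lemma solutionS v x : solution v x ->
  forall n, x (n + 1) = - v n * x n - x (n - 1).
Proof. by move=> hx n; have := hx n; rewrite /schrod => h; lra. Qed.

Lemma solutionP v x : solution v x ->
  forall n, x (n - 1) = - v n * x n - x (n + 1).
Proof. by move=> hx n; have := hx n; rewrite /schrod => h; lra. Qed.

Lemma solution_lin v x y a b : solution v x -> solution v y ->
  solution v (fun n => a * x n + b * y n).
Proof.
move=> hx hy n; rewrite /schrod.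
by rewrite (solutionS hx n) (solutionS hy n); ring.
Qed.

Lemma solution_shift v x (k : int) : solution v x ->
  solution (fun n => v (n + k)) (fun n => x (n + k)).
Proof.
move=> hx n; have := hx (n + k); rewrite /schrod.
by rewrite (addrAC n k 1) (addrAC n k (- 1)).
Qed.

(** Agreement of the images is only required to the right of [c], because a preimage of delta_0 will
    be compared with a solution on a half-line; the recursion propagates the two initial values. *)
Lemma right_eq v x y (c : int) :
  (forall n, c < n -> schrod v x n = schrod v y n) ->
  x c = y c -> x (c + 1) = y (c + 1) -> forall n, c <= n -> x n = y n.
Proof.
move=> hx x0 x1 n le_cn.
have -> : n = c + (absz (n - c))%:Z by lia.
suff: x (c + (absz (n - c))%:Z) = y (c + (absz (n - c))%:Z) /\
  x (c + (absz (n - c))%:Z + 1) = y (c + (absz (n - c))%:Z + 1) by case.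
elim: (absz _) => [|m [h1 h2]]; first by rewrite addr0.
have -> : c + m.+1%:Z = c + m%:Z + 1 by lia.
split=> //; have /hx := (ltac:(lia) : c < c + m%:Z + 1); rewrite /schrod addrK.
by rewrite h1 h2 => /addIr /addIr.
Qed.

Lemma left_eq v x y (c : int) :
  (forall n, n < c -> schrod v x n = schrod v y n) ->
  x c = y c -> x (c - 1) = y (c - 1) -> forall n, n <= c -> x n = y n.
Proof.
move=> hx x0 x1 n le_cn.
(* The reflection n -> -n preserves the form of the equation and turns left into right. *)
rewrite -(opprK n).
apply: (@right_eq (fun n => v (- n)) (fun n => x (- n)) (fun n => y (- n)) (- c));
  rewrite ?lerN2 ?opprK //.
- move=> m lt_cm; have /hx := (ltac:(lia) : - m < c).
  rewrite /schrod.
  have -> : - (m + 1) = - m - 1 by lia.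
  have -> : - (m - 1) = - m + 1 by lia.
  by rewrite [x _ + _]addrC [y _ + _]addrC.
- by have -> : - (- c + 1) = c - 1 by lia.
Qed.

Lemma solution_eq v x y j : solution v x -> solution v y ->
  x j = y j -> x (j + 1) = y (j + 1) -> x =1 y.
Proof.
move=> hx hy e0 e1 n; have [le_jn|lt_nj] := leP j n.
  by apply: (@right_eq v x y j) => // m _; rewrite hx hy.
apply: (@left_eq v x y (j + 1)); [|by []|by rewrite addrK|lia].
by move=> m _; rewrite hx hy.
Qed.

Lemma solution_eq0 v x j : solution v x ->
  x j = 0 -> x (j + 1) = 0 -> forall n, x n = 0.
Proof.
move=> hx x0 x1; apply: (solution_eq (y := fun=> 0) hx _ x0 x1) => n.
by rewrite /schrod mulr0 !addr0.
Qed.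

(** Here [b] is the value at index -1. By reflection symmetry the same recursion, run along the
    potential read backwards, gives the left half of a two-sided solution. *)
Fixpoint halfsol (w : nat -> R) (a b : R) (n : nat) : R :=
  match n with
  | 0%N => a
  | n'.+1 => - w n' * halfsol w a b n' -
             (if n' is n''.+1 then halfsol w a b n'' else b)
  end.

(* The solution with [x 0 = a] and [x (-1) = b]; [Negz n] stands for [-(n+1)]. *)
Definition sol v (a b : R) n : R :=
  match n with
  | Posz m => halfsol (fun i => v i%:Z) a b m
  | Negz m => halfsol (fun i => v (Negz i)) b a m
  end.

Lemma sol0 v a b : sol v a b 0 = a. Proof. by []. Qed.
Lemma solN1 v a b : sol v a b (- 1) = b. Proof. by []. Qed.

Lemma sol_solution v a b : solution v (sol v a b).
Proof.
case=> [[|m]|m]; rewrite /schrod.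
- by rewrite (_ : Posz 0 + 1 = Posz 1) // (_ : Posz 0 - 1 = Negz 0) //=; ring.
- have -> : m.+1%:Z + 1 = m.+2 by lia.
  have -> : m.+1%:Z - 1 = m by lia.
  by rewrite /=; ring.
- have -> : Negz m - 1 = Negz m.+1 by lia.
  case: m => [|m].
    by have -> : Negz 0 + 1 = 0 by []; rewrite /=; ring.
  have -> : Negz m.+1 + 1 = Negz m by lia.
  by rewrite /=; ring.
Qed.

Arguments sol : simpl never.

Lemma sol_comb v x : solution v x ->
  forall n, x n = x 0 * sol v 1 0 n + x (- 1) * sol v 0 1 n.
Proof.
move=> hx; apply: (@solution_eq v _ _ (- 1)) => //.
- by apply: solution_lin; exact: sol_solution.
- by rewrite !solN1; ring.
- by rewrite !sol0; ring.
Qed.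

Lemma wronskian_const v x y : solution v x -> solution v y ->
  forall n m : int, x n * y (n + 1) - x (n + 1) * y n =
                    x m * y (m + 1) - x (m + 1) * y m.
Proof.
move=> hx hy.
have step n : x (n + 1) * y (n + 1 + 1) - x (n + 1 + 1) * y (n + 1) =
    x n * y (n + 1) - x (n + 1) * y n.
  by rewrite (solutionS hx (n + 1)) (solutionS hy (n + 1)) addrK; ring.
have up (k : nat) n : x (n + k%:Z) * y (n + k%:Z + 1) - x (n + k%:Z + 1) * y (n + k%:Z) =
    x n * y (n + 1) - x (n + 1) * y n.
  elim: k => [|k <-]; first by rewrite addr0.
  by have -> : n + k.+1%:Z = n + k%:Z + 1 by lia.
move=> n m; have [le_nm|lt_mn] := leP n m.
  by rewrite -(up (absz (m - n)) n); have -> : n + (absz (m - n))%:Z = m by lia.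
by rewrite -(up (absz (n - m)) m); have -> : m + (absz (n - m))%:Z = n by lia.
Qed.

(** The factor [tmx (v n)] sends (x n, x (n-1)) to (x (n+1), x n), so the columns of M are the
    fundamental solutions with data (1,0) and (0,1) at the places 0 and -1, read at K and K-1. *)
Lemma monodromyE v K : monodromy v K =
  \matrix_(i, j) sol v (j == 0 :> nat)%:R (j != 0 :> nat)%:R (K%:Z - i%:Z).
Proof.
elim: K => [|K IH].
  rewrite /monodromy big_ord0; apply/matrixP => i j; rewrite !mxE.
  by case: i => [[|[|i]] Hi] //; case: j => [[|[|j]] Hj].
have -> : monodromy v K.+1 = tmx (v K%:Z) *m monodromy v K.
  rewrite /monodromy big_ord_recl /= subn0; congr (_ *m _).
  apply: eq_bigr => i _; congr (tmx (v _%:Z)).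
  by rewrite /bump /=; lia.
rewrite IH; apply/matrixP => i j; rewrite !mxE big_ord_recl big_ord1 !mxE /=.
case: i => [[|[|i]] Hi] //=.
  have -> : K.+1%:Z - 0%:Z = K%:Z + 1 by lia.
  rewrite (solutionS (@sol_solution v _ _)) subr0.
  by rewrite mulN1r /bump /=.
have -> : K.+1%:Z - 1%:Z = K%:Z by lia.
by rewrite subr0 mul1r mul0r addr0.
Qed.

Lemma monodromy_tr v K :
  \tr (monodromy v K) = sol v 1 0 K%:Z + sol v 0 1 (K%:Z - 1).
Proof. by rewrite monodromyE /mxtrace big_ord_recl big_ord1 !mxE /= subr0. Qed.

(** For n = K this is det M = 1. *)
Lemma sol_det v n :
  sol v 1 0 n * sol v 0 1 (n - 1) - sol v 0 1 n * sol v 1 0 (n - 1) = 1.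
Proof.
have := @wronskian_const v _ _ (@sol_solution v 1 0) (@sol_solution v 0 1)
  (n - 1) (- 1).
by rewrite subrK !sol0 !solN1 => h; lra.
Qed.

(** * Periodic potentials and Floquet solutions *)

Section Periodic.
Context (v : int -> R) (K : nat).
Hypothesis vK : forall n, v (n + K%:Z) = v n.
Local Notation t := (\tr (monodromy v K)).

Lemma periodic_nat (T : Type) (g : int -> T) :
  (forall n, g (n + K%:Z) = g n) -> forall n (m : nat), g (n + m%:Z * K%:Z) = g n.
Proof.
move=> gK n; elim=> [|m IH]; first by rewrite mul0r addr0.
by rewrite -IH -[RHS]gK -addn1 PoszD mulrDl mul1r addrA.
Qed.

Lemma solution_period x : solution v x -> solution v (fun n => x (n + K%:Z)).
Proof.
by move=> hx n; have := solution_shift K%:Z hx n; rewrite /schrod vK.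
Qed.

(** Cayley-Hamilton for M, whose determinant is 1. Both sides are solutions in n, so it is enough to
    compare them at -1 and 0, where the claim is one row of M^2 = tM - 1. *)
Lemma floquet x : solution v x ->
  forall n, x (n + K%:Z + K%:Z) = t * x (n + K%:Z) - x n.
Proof.
move=> hx n; rewrite monodromy_tr.
set x1 := fun n => x (n + K%:Z).
have hx1 : solution v x1 by exact: solution_period.
have hx2 : solution v (fun n => x1 (n + K%:Z)) by exact: solution_period.
apply: (@solution_eq v _ (fun n => (_ + _) * x1 n - x n) (- 1) hx2) => {n}.
- move=> n; have := @solution_lin v x1 x (sol v 1 0 K%:Z + sol v 0 1 (K%:Z - 1)) (-1) hx1 hx n.
  by rewrite /schrod => h; rewrite -[RHS]h; ring.
- have E : x1 (- 1 + K%:Z) = x1 0 * sol v 1 0 (K%:Z - 1) + x1 (- 1) * sol v 0 1 (K%:Z - 1).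
    by rewrite addrC; exact: sol_comb.
  rewrite E /x1 add0r (sol_comb hx K) [- 1 + K%:Z]addrC (sol_comb hx (K%:Z - 1)).
  have D := sol_det v K%:Z.
  have -> : forall a b F G F1 G1 : R, F * G1 - G * F1 = 1 ->
     (a * F + b * G) * F1 + (a * F1 + b * G1) * G1 = (F + G1) * (a * F1 + b * G1) - b.
    by move=> a b F G F1 G1 h; rewrite -[X in _ - X]mulr1 -h; ring.
  by [].
  exact: D.
- rewrite addNr (sol_comb hx1 (0 + K%:Z)) /x1 add0r (sol_comb hx K).
  rewrite [- 1 + K%:Z]addrC (sol_comb hx (K%:Z - 1)).
  have D := sol_det v K%:Z.
  have -> : forall a b F G F1 G1 : R, F * G1 - G * F1 = 1 ->
     (a * F + b * G) * F + (a * F1 + b * G1) * G = (F + G1) * (a * F + b * G) - a.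
    by move=> a b F G F1 G1 h; rewrite -[X in _ - X]mulr1 -h; ring.
  by [].
  exact: D.
Qed.

(** On solutions the shift T by K satisfies (T - nu)(T - nu^-1) = 0, so every nonzero element of the
    image of T - nu^-1 is an eigenvector for nu. If that image were zero, T would be nu^-1 times the
    identity, and its determinant nu^-2 = 1 would contradict the hypothesis. *)
Lemma floquet_exists (nu : R) : nu != 0 -> nu ^+ 2 != 1 -> t = nu + nu^-1 ->
  exists x, [/\ solution v x, forall n, x (n + K%:Z) = nu * x n &
                exists n, x n != 0].
Proof.
move=> nu0 nu1 tE.
have key x : solution v x -> let e n := 1 * x (n + K%:Z) + - nu^-1 * x n in
    [/\ solution v e & forall n, e (n + K%:Z) = nu * e n].
  move=> hx e; split; first by apply: solution_lin => //; exact: solution_period.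
  by move=> n; rewrite /e (floquet hx) tE; field.
have [h1 p1] := key _ (@sol_solution v 1 0).
have [h2 p2] := key _ (@sol_solution v 0 1).
have [[n n1]|N1] := pselect (exists n, 1 * sol v 1 0 (n + K%:Z) + - nu^-1 * sol v 1 0 n != 0).
  by eexists; split; [exact: h1|exact: p1|exists n].
have [[n n1]|N2] := pselect (exists n, 1 * sol v 0 1 (n + K%:Z) + - nu^-1 * sol v 0 1 n != 0).
  by eexists; split; [exact: h2|exact: p2|exists n].
exfalso; move/forallNP : N1 => N1; move/forallNP : N2 => N2.
have {}N1 n : sol v 1 0 (n + K%:Z) = nu^-1 * sol v 1 0 n.
  by have /negP := N1 n; rewrite negbK => /eqP; lra.
have {}N2 n : sol v 0 1 (n + K%:Z) = nu^-1 * sol v 0 1 n.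
  by have /negP := N2 n; rewrite negbK => /eqP; lra.
have := sol_det v K%:Z.
rewrite -[K%:Z]add0r N1 N2 add0r [_ - 1]addrC N1 N2 !sol0 !solN1.
rewrite mulr0 mul0r !mulr1 subr0 => /eqP; rewrite -invfM invr_eq1 -expr2.
by move: nu1 => /negPf ->.
Qed.

Lemma periodic_bounded (g : int -> R) : (0 < K)%N ->
  (forall n, g (n + K%:Z) = g n) -> exists C, 0 < C /\ forall n, `|g n| <= C.
Proof.
move=> K0 gK; exists (1 + \sum_(i < K) `|g i%:Z|); split.
  by rewrite ltr_pwDl// sumr_ge0.
move=> n; have K0' : K%:Z != 0 by lia.
have -> : g n = g (n %% K%:Z)%Z.
  have E := divz_eq n K%:Z.
  have [q0|q0] := leP 0 (n %/ K%:Z)%Z.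
    rewrite {1}E -(@periodic_nat _ g gK (n %% K%:Z)%Z (absz (n %/ K%:Z)%Z)).
    by congr (g _); lia.
  by rewrite -(@periodic_nat _ g gK n (absz (n %/ K%:Z)%Z)); congr (g _); lia.
have := modz_ge0 n K0'; have := ltz_pmod n (ltac:(lia) : 0 < K%:Z).
case: (n %% K%:Z)%Z => // m; rewrite ltz_nat => mK _.
by rewrite (bigD1 (Ordinal mK)) //= addrCA lerDl addr_ge0// sumr_ge0.
Qed.

End Periodic.
End Solutions.

(** * Solutions with two zeros one period apart *)

Section RationalRoots.
Implicit Types (p d : seq int) (a b c : int).

Definition peval (F : fieldType) p (x : F) : F :=
  foldr (fun c s => c%:~R + x * s) 0 p.

(* [b ^ (size p).-1 * p(a / b)], the homogenized polynomial. *)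
Fixpoint hom p a b : int :=
  if p is c :: p' then c * b ^+ size p' + a * hom p' a b else 0.

(** The extra factor [b] accounts for [size p] being one more than the formal degree, and makes the
    identity hold for the empty list too. *)
Lemma homE (F : numFieldType) p a b : b != 0 ->
  (b * hom p a b)%:~R = b%:~R ^+ size p * peval p (a%:~R / b%:~R) :> F.
Proof.
move=> b0; have b0' : b%:~R != 0 :> F by rewrite intr_eq0.
elim: p => [|c p IH] /=; first by rewrite !mulr0.
rewrite mulrDr intrD [b * (a * _)]mulrCA [X in _ + X]intrM IH.
by rewrite !intrM rmorphXn /= exprS; field.
Qed.

Lemma hom_dvd_head p c a b : coprimez a b -> hom (c :: p) a b = 0 ->
  (a %| c)%Z.
Proof.
move=> co /eqP; rewrite /= addr_eq0 => /eqP h.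
have : (a %| c * b ^+ size p)%Z by rewrite h rpredN dvdz_mulr.
by rewrite Gauss_dvdzl // coprimezXr.
Qed.

Lemma hom_dvd_last p c a b : coprimez a b -> hom (c :: p) a b = 0 ->
  (b %| last c p)%Z.
Proof.
move=> co h0; rewrite -(@Gauss_dvdzr _ (a ^+ size p)); last first.
  by rewrite coprimezXr // coprimez_sym.
(* Modulo [b] only the leading term of [hom] survives; the induction below proves this
   congruence. *)
rewrite (_ : _ * _ = a ^+ size p * last c p - hom (c :: p) a b); last first.
  by rewrite h0 subr0.
move: c {h0}; elim: p => [|c' p IH] c.
  by rewrite /= mul1r mulr1 mulr0 addr0 subrr dvdz0.
have -> : a ^+ size (c' :: p) * last c (c' :: p) - hom (c :: c' :: p) a b =
    a * (a ^+ size p * last c' p - hom (c' :: p) a b) - c * b ^+ (size p) * b.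
  by rewrite /= !exprS; ring.
by rewrite rpredB // ?dvdz_mull.
Qed.

(** Coefficients are listed from the constant term up. [trim] removes vanishing leading coefficients
    and [dropz] removes factors of the variable; then both end coefficients are nonzero and the
    rational root theorem leaves finitely many candidates. *)
Definition trim p :=
  foldr (fun c s => if (c == 0) && nilp s then [::] else c :: s) [::] p.

Fixpoint dropz p := if p is c :: p' then if c == 0 then dropz p' else p else p.

Lemma peval_trim (F : fieldType) p (x : F) : peval (trim p) x = peval p x.
Proof.
elim: p => //= c p IH; case: ifP => [/andP[/eqP -> /nilP h]|_] /=; last by rewrite IH.
by rewrite -IH h /= mulr0 add0r.
Qed.

Lemma peval_dropz (F : fieldType) p (x : F) : x != 0 -> peval p x = 0 ->
  peval (dropz p) x = 0.
Proof.
move=> x0; elim: p => //= c p IH; case: eqP => [->|//].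
by rewrite add0r => /eqP; rewrite mulf_eq0 (negPf x0) /= => /eqP.
Qed.

Definition is_pm1 p a b : bool :=
  (b * hom p a b == b ^+ size p) || (b * hom p a b == - b ^+ size p).

(* Every non-integral rational zero [a / b] of [p] is a point where [d] is
   [1] or [-1]; the candidates come from the rational root theorem. *)
Definition check_roots p d : bool :=
  match dropz (trim p) with
  | [::] => (trim d == [:: 1]) || (trim d == [:: -1])
  | c :: p' =>
      all (fun n : nat => all (fun m : nat =>
          all (fun a => if hom (c :: p') a m%:Z == 0 then is_pm1 d a m%:Z else true)
          [:: n%:Z; - n%:Z])
        (iota 2 (absz (last c p')).-1)) (iota 1 (absz c))
  end.

Lemma last_dropz_trim p c p' : dropz (trim p) = c :: p' -> last c p' != 0.
Proof.
have t : forall p, nilp (trim p) || (last 0 (trim p) != 0).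
  elim=> //= c0 p0; case: ifP => //= /negbT; rewrite negb_and.
  by case: (trim p0) => [|c1 p1] //=; rewrite orbF.
move=> h; have : last 0 (dropz (trim p)) != 0.
  have := t p; have : ~~ nilp (dropz (trim p)) by rewrite h.
  elim: (trim p) => //= c1 p1 IH; case: eqP => [_|//] n1.
  case: p1 IH n1 => //= c2 p2 IH; exact: IH.
by rewrite h.
Qed.

Lemma head_dropz p c p' : dropz p = c :: p' -> c != 0.
Proof. by elim: p => //= c1 p1 IH; case: eqP => [_|/eqP h [<- _]]. Qed.

(** The numerator of a zero divides the lowest coefficient and the denominator divides the leading
    one, so a/b is among the candidates tested. *)
Lemma check_rootsP (F : numFieldType) p d a b : check_roots p d ->
  coprimez a b -> 2 <= b -> peval p (a%:~R / b%:~R : F) = 0 ->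
  a != 0 -> peval d (a%:~R / b%:~R : F) ^+ 2 = 1.
Proof.
move=> ch co b2 p0 a0.
have b0 : b != 0 by lia.
have b0' : b%:~R != 0 :> F by rewrite intr_eq0.
have x0 : a%:~R / b%:~R != 0 :> F by rewrite mulf_neq0 ?invr_eq0 ?intr_eq0.
move: ch; rewrite /check_roots; case E : (dropz (trim p)) => [|c p'].
  (* For the zero polynomial every point is a zero, and the check demands that [d] be the constant 1
     or -1. *)
  by rewrite -[peval d _]peval_trim => /orP[] /eqP -> /=; rewrite mulr0 addr0 ?sqrrN ?expr1n.
have lp := last_dropz_trim E; have hp := head_dropz E.
have : peval (c :: p') (a%:~R / b%:~R : F) = 0.
  by rewrite -E; apply: peval_dropz => //; rewrite peval_trim.
move=> h0.
have h : hom (c :: p') a b = 0.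
  have /eqP := @homE F (c :: p') a b b0.
  by rewrite h0 mulr0 intr_eq0 mulf_eq0 (negPf b0) /= => /eqP.
have ac := hom_dvd_head co h; have bl := hom_dvd_last co h.
have a_le : (absz a <= absz c)%N.
  by apply: dvdn_leq; [lia|move: ac; rewrite dvdzE].
have b_le : (absz b <= absz (last c p'))%N.
  by apply: dvdn_leq; [lia|move: bl; rewrite dvdzE].
move=> /allP /(_ (absz a)); rewrite mem_iota (_ : _ && _); last by lia.
move=> /(_ isT).
move=> /allP /(_ (absz b)); rewrite mem_iota (_ : _ && _); last by lia.
move=> /(_ isT).
have -> : `|b|%N%:Z = b by lia.
have /orP[] : (a == `|a|%N%:Z) || (a == - `|a|%N%:Z) by lia.
all: move=> /eqP <- /=; move: h => /= ->; rewrite eqxx /= => /and3P[h1 h2 _].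
all: have {h1 h2} : is_pm1 d a b by [].
all: have bn0 : b%:~R ^+ size d != 0 :> F by rewrite expf_neq0.
all: rewrite /is_pm1 => /orP[] /eqP /(congr1 (fun z => z%:~R : F)).
all: rewrite homE // ?rmorphN rmorphXn /= => /(canRL (mulKf bn0)) ->.
all: by rewrite ?mulrN ?sqrrN mulVf // expr1n.
Qed.

End RationalRoots.

(** * Potentials with values 0 and lambda as binary words *)

Section Words.

Fixpoint psub (p q : seq int) : seq int :=
  match p, q with
  | [::], _ => map -%R q
  | _, [::] => p
  | a :: p', b :: q' => (a - b) :: psub p' q'
  end.

Lemma peval_sub (F : fieldType) p q (x : F) :
  peval (psub p q) x = peval p x - peval q x.
Proof.
have eN s : peval (map -%R s) x = - peval s x.
  by elim: s => [|c s IH] /=; rewrite ?oppr0 // IH rmorphN /=; ring.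
elim: p q => [|a p IH] [|b q] /=; rewrite ?subr0 ?sub0r //.
- by rewrite eN rmorphN /=; ring.
- by rewrite IH rmorphB /=; ring.
Qed.

(* The two latest terms, as polynomials in lambda, of the solution with
   initial values [1, 0] when the potential spells the word (latest letter
   first) in the alphabet [0 = false, lambda = true]. *)
Fixpoint word_poly (w : seq bool) : seq int * seq int :=
  if w is c :: w' then
    let: (p, q) := word_poly w' in
    (psub (if c then 0 :: map -%R p else [::]) q, p)
  else ([:: 1], [::]).

Fixpoint all_words k (P : seq bool -> bool) : bool :=
  if k is k'.+1 then
    all_words k' (fun w => P (true :: w)) && all_words k' (fun w => P (false :: w))
  else P [::].

Lemma all_wordsP k P : all_words k P -> forall w, size w = k -> P w.
Proof.
elim: k P => [|k IH] P /=; first by move=> ? [].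
by move=> /andP[/IH h1 /IH h2] [//|[] w] [] /[dup] ? => [/h1|/h2].
Qed.

Definition check_word w := let: (p, q) := word_poly w in check_roots p q.

(** The finite computation behind the assumption K <= 8: if the latest term vanishes at a
    non-integral rational lambda, the term before it is 1 or -1 there. Words of length K - 1 <= 7
    suffice, since the second zero of the solution lies K - 1 steps after its initial value 1. *)
Lemma check_words : all (fun k => all_words k check_word) (iota 0 8).
Proof. by vm_compute. Qed.

End Words.

(** * The arithmetic assumptions applied to two zeros one period apart *)

Section Dirichlet.
Context {R : realType}.

Lemma halfsol_int (w : nat -> R) (a b : R) n : (forall i, w i \is a Num.int) ->
  a \is a Num.int -> b \is a Num.int -> halfsol w a b n \is a Num.int.
Proof.
move=> hw ha hb; elim/ltn_ind: n => [[//|n]] IH /=.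
rewrite rpredB// ?rpredM ?rpredN ?IH //.
by case: n IH => // n IH; exact: IH.
Qed.

Lemma int_mulr_eq1 (x y : R) : x \is a Num.int -> y \is a Num.int ->
  x * y = 1 -> x ^+ 2 = 1.
Proof.
move=> /intrP[a ->] /intrP[b ->]; rewrite -intrM => /eqP.
rewrite -[1]/(1%:~R) eqr_int => /eqP h.
have : `|a|%N = 1%N.
  have /(congr1 absz) := h; rewrite abszM => /eqP.
  by rewrite muln_eq1 => /andP[/eqP].
by move=> h1; rewrite -rmorphXn /=; congr (_%:~R); lia.
Qed.

Lemma halfsol_det (w : nat -> R) n :
  halfsol w 1 0 n.+1 * halfsol w 0 1 n - halfsol w 0 1 n.+1 * halfsol w 1 0 n = 1.
Proof. by elim: n => [|n IH]; [rewrite /=; ring|rewrite -[RHS]IH /=; ring]. Qed.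

Definition word_of (w : nat -> R) k := [seq w i != 0 | i <- rev (iota 0 k)].

Lemma word_ofS w k : word_of w k.+1 = (w k != 0) :: word_of w k.
Proof. by rewrite /word_of -addn1 iotaD rev_cat. Qed.

Lemma word_polyE (w : nat -> R) (lam : R) k : (forall i, w i = 0 \/ w i = lam) ->
  halfsol w 1 0 k.+1 = peval (word_poly (word_of w k.+1)).1 lam /\
  halfsol w 1 0 k = peval (word_poly (word_of w k.+1)).2 lam.
Proof.
move=> hw.
have step i p : peval (if w i != 0 then 0 :: map -%R p else [::]) lam = - w i * peval p lam.
  have eN s : peval (map -%R s) lam = - peval s lam.
    by elim: s => [|c s IH] /=; rewrite ?oppr0 // IH rmorphN /=; ring.
  case: eqP => [->|/eqP wi0] /=; first by ring.
  by rewrite eN; case: (hw i) => h; [rewrite h eqxx in wi0|rewrite h; ring].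
elim: k => [|k [IH1 IH2]].
  move: (step 0%N [:: 1]); rewrite word_ofS /= peval_sub => ->.
  by rewrite /=; split; ring.
rewrite word_ofS; move: IH1 IH2.
rewrite [word_poly (_ :: _)]/=; case: (word_poly _) => p q /= IH1 IH2.
by rewrite peval_sub step -IH1 -IH2 /=.
Qed.

(* The three arithmetic assumptions enter only here. *)
Lemma dirichlet_period (v : int -> R) (K : nat) : (0 < K)%N ->
  [\/ K = 2%N,
      (K <= 8)%N /\ (exists lam : rat,
          forall n : int, v n = 0 \/ v n = ratr lam)
    | forall n : int, v n \is a Num.int] ->
  forall x j, solution v x -> x j = 0 -> x (j + K%:Z) = 0 ->
    x (j + 1 + K%:Z) ^+ 2 = x (j + 1) ^+ 2.
Proof.
move=> K0 hyp x j hx xj xjK.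
(* The translation puts the first zero at -1, so that the solution is a multiple of the fundamental
   solution with data (1,0). *)
pose w n := v (n + (j + 1)); pose y n := x (n + (j + 1)).
have hy : solution w y by exact: solution_shift.
have yE n : y n = y 0 * sol w 1 0 n.
  rewrite (sol_comb hy n) (_ : y (- 1) = 0) ?mul0r ?addr0 //.
  by rewrite /y addrCA addNr addr0.
have -> : x (j + 1 + K%:Z) = y K%:Z by rewrite /y addrC.
have -> : x (j + 1) = y 0 by rewrite /y add0r.
have yK : y (K%:Z - 1) = 0 by rewrite -xjK /y; congr x; lia.
have [y0|y0] := eqVneq (y 0) 0; first by rewrite yE y0 mul0r.
move: yK; rewrite yE => /eqP; rewrite mulf_eq0 (negPf y0) /= => /eqP.
rewrite yE exprMn; case: K K0 hyp {xjK} => // k _ hyp.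
have -> : k.+1%:Z - 1 = k by lia.
rewrite /sol; set w' := fun i : nat => w i => F0.
suff -> : halfsol w' 1 0 k.+1 ^+ 2 = 1 by rewrite mulr1.
(* With integer potential the determinant identity, in which [F0] kills one product, exhibits the
   wanted value as a unit of the integers. *)
have integral : (forall n, w' n \is a Num.int) -> halfsol w' 1 0 k.+1 ^+ 2 = 1.
  move=> hw; apply: (@int_mulr_eq1 _ (halfsol w' 0 1 k)); rewrite ?halfsol_int//.
  by have := halfsol_det w' k; rewrite F0 mulr0 subr0.
case: hyp => [[k1]|[k8 [lam hlam]]|hv]; last by apply: integral => n; exact: hv.
  rewrite k1 /= in F0 *.
  have -> : w' 0%N = 0 by lra.
  by ring.
have hw i : w' i = 0 \/ w' i = ratr lam by exact: hlam.
case: k F0 k8 integral => [|k] F0 k8 integral.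
  by move: F0 => /= /eqP; rewrite oner_eq0.
(* An integral lambda falls under the integer case; the word check treats the denominators at least
   2. *)
have [d1|d1] := eqVneq (denq lam) 1.
  apply: integral => n; case: (hw n) => ->; first exact: rpred0.
  by rewrite /ratr d1 divr1 intr_int.
have [E1 E2] := word_polyE k hw.
(* The terms on the two sides of a zero are opposite, so the question moves to the term before the
   zero, which [check_word] controls. *)
have -> : halfsol w' 1 0 k.+2 ^+ 2 = halfsol w' 1 0 k ^+ 2.
  rewrite -[halfsol w' 1 0 k.+2]/(- w' k.+1 * halfsol w' 1 0 k.+1 - halfsol w' 1 0 k).
  by rewrite F0 mulr0 sub0r sqrrN.
have ch : check_word (word_of w' k.+1).
  have := check_words => /allP /(_ k.+1); rewrite mem_iota k8 => /(_ isT).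
  by move=> /all_wordsP; apply; rewrite size_map size_rev size_iota.
have a0 : numq lam != 0.
  by apply: contra_neq d1 => /eqP; rewrite numq_eq0 => /eqP ->.
have b2 : 2 <= denq lam by have := denq_gt0 lam; lia.
rewrite E2; move: ch E1; rewrite F0 /check_word {E2}.
case: (word_poly _) => p q ch /esym E1.
by apply: (check_rootsP ch) => //; rewrite coprimezE coprime_num_den.
Qed.

End Dirichlet.

(** * Absolutely convergent sums over the integers *)

Section Sums.
Context {R : realType}.
Implicit Types (a b f g : int -> R) (N : nat).

Lemma sub_esum (T : choiceType) (A B : set T) (f : T -> \bar R) :
  A `<=` B -> (forall i, (0 <= f i)%E) ->
  (\esum_(i in A) f i <= \esum_(i in B) f i)%E.
Proof.
move=> AB f0; rewrite esum_mkcond [leRHS]esum_mkcond; apply: le_esum => i _.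
case: ifPn => [|_]; last by case: ifP.
by rewrite inE => /AB; rewrite -inE => ->.
Qed.

Lemma esumZ_le (T : choiceType) (A : set T) (c : R) (f : T -> \bar R) :
  0 <= c -> (forall i, (0 <= f i)%E) ->
  (\esum_(i in A) (c%:E * f i) <= c%:E * \esum_(i in A) f i)%E.
Proof.
move=> c0 f0; apply: ge_ereal_sup => _ [X XA <-].
rewrite -ge0_mule_fsumr //; apply: lee_wpmul2l; first by rewrite lee_fin.
by apply: ereal_sup_ubound; exists X.
Qed.

Lemma esum_swap (T1 T2 : choiceType) (f : T1 -> T2 -> \bar R) :
  (forall i j, (0 <= f i j)%E) ->
  (\esum_(i in [set: T1]) \esum_(j in [set: T2]) f i j =
   \esum_(j in [set: T2]) \esum_(i in [set: T1]) f i j)%E.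
Proof.
move=> f0; rewrite !esum_esum //.
rewrite (@reindex_esum _ _ _ ([set: T2] `*`` fun=> [set: T1])
  ([set: T1] `*`` fun=> [set: T2]) (fun k => (k.2, k.1))) //.
split=> [|x y _ _ [] e1 e2|]; [by []| |].
  by case: x y e1 e2 => [? ?] [? ?] /= -> ->.
by move=> [i j] _; exists (j, i).
Qed.

Lemma esum_term (T : choiceType) (f : T -> \bar R) (i : T) :
  (forall i, (0 <= f i)%E) -> (f i <= \esum_(j in [set: T]) f j)%E.
Proof. by move=> f0; rewrite -(esum_set1 (f0 i)); exact: sub_esum. Qed.

(** The indexing is that of [fsection], so a row of a finite section applied to a vector is such a
    sum. *)
Definition psum N a : R := \sum_(j < N.*2.+1) a (j%:Z - N%:Z).

Lemma eq_psum N a b : (forall j, (absz j <= N)%N -> a j = b j) -> psum N a = psum N b.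
Proof. by move=> e; apply: eq_bigr => j _; apply: e; have := ltn_ord j; lia. Qed.

Lemma le_psum N a b : (forall j, a j <= b j) -> psum N a <= psum N b.
Proof. by move=> ab; apply: ler_sum. Qed.

Lemma psum_lin N (c d : R) a b :
  psum N (fun j => c * a j + d * b j) = c * psum N a + d * psum N b.
Proof. by rewrite /psum big_split -!mulr_sumr. Qed.

Lemma ler_norm_psum N a : `|psum N a| <= psum N (fun j => `|a j|).
Proof. exact: ler_norm_sum. Qed.

Lemma psumS N a : psum N.+1 a = psum N a + a N.+1%:Z + a (- N.+1%:Z).
Proof.
rewrite /psum doubleS big_ord_recl big_ord_recr /= sub0r.
rewrite [LHS]addrC; congr (_ + _ + _); last by congr a; rewrite /bump /=; lia.
by apply: eq_bigr => j _; congr a; rewrite /bump /=; lia.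
Qed.

Lemma psum_delta N (k : int) g :
  psum N (fun j => (j == k)%:R * g j) = if (absz k <= N)%N then g k else 0.
Proof.
rewrite /psum; case: ifPn => kN.
  have hk : (absz (k + N%:Z)%R < N.*2.+1)%N by lia.
  rewrite (bigD1 (Ordinal hk)) //= big1 ?addr0; last first.
    move=> i /eqP ik; rewrite (_ : _ == _ = false) ?mul0r //.
    by apply/eqP => h; apply: ik; apply: val_inj => /=; lia.
  have -> : (absz (k + N%:Z)%R)%:Z - N%:Z = k by lia.
  by rewrite eqxx mul1r.
rewrite big1 // => j _; rewrite (_ : _ == _ = false) ?mul0r //.
by apply/eqP; have := ltn_ord j; lia.
Qed.

Lemma psum_stable N M a : (forall j, (N < absz j)%N -> a j = 0) -> (N <= M)%N ->
  psum M a = psum N a.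
Proof.
move=> a0; elim: M => [|M IH]; first by rewrite leqn0 => /eqP ->.
rewrite leq_eqVlt => /orP[/eqP -> //|NM].
by rewrite psumS IH // !a0 ?addr0 //; lia.
Qed.

Lemma psum_homo a : (forall j, 0 <= a j) ->
  {homo psum^~ a : n m / (n <= m)%N >-> n <= m}.
Proof.
move=> a0; apply: homo_leq => [|y x z|n]; [exact: lexx|exact: le_trans|].
by rewrite psumS -addrA lerDl addr_ge0.
Qed.

Lemma esum_ball N f : (forall j, 0 <= f j) ->
  (\esum_(n in [set n : int | (absz n <= N)%N]) (f n)%:E = (psum N f)%:E)%E.
Proof.
move=> f0; rewrite (@reindex_esum _ nat _ `I_(N.*2.+1) _ (fun j => j%:Z - N%:Z)).
  rewrite esum_fset //; last by move=> i _; rewrite lee_fin.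
  rewrite -fsbig_ord /psum -sumEFin //.
split=> [j /=|i j _ _|n /= nN]; [lia|lia|].
by exists (absz (n + N%:Z)%R) => /=; lia.
Qed.

Lemma psum_le_esum N f : (forall j, 0 <= f j) ->
  ((psum N f)%:E <= \esum_(n in [set: int]) (f n)%:E)%E.
Proof. by move=> f0; rewrite -esum_ball //; apply: sub_esum => // i; rewrite lee_fin. Qed.

Lemma finite_set_int (A : set int) : finite_set A ->
  exists N : nat, A `<=` [set n | (absz n <= N)%N].
Proof.
move=> /finite_fsetP[F ->]; exists (\max_(n <- finmap.enum_fset F) absz n) => n /= nF.
by apply: (@leq_bigmax_seq _ _ _ absz) => //.
Qed.

Lemma esum_le_psum f (B : \bar R) : (forall j, 0 <= f j) ->
  (forall N, (psum N f)%:E <= B)%E -> (\esum_(n in [set: int]) (f n)%:E <= B)%E.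
Proof.
move=> f0 fB; apply: ge_ereal_sup => _ [X [finX _] <-].
have [N XN] := finite_set_int finX; apply: le_trans (fB N).
rewrite -esum_ball // -esum_fset //; last by move=> i _; rewrite lee_fin.
by apply: sub_esum => // i; rewrite lee_fin.
Qed.

(** Some finite set carries all of the sum but [e], and it lies in a ball [-N,N]. *)
Lemma esum_tail f (e : R) : (forall j, 0 <= f j) -> 0 < e ->
  (\esum_(n in [set: int]) (f n)%:E < +oo)%E ->
  exists N : nat, (\esum_(n in [set n : int | (N < absz n)%N]) (f n)%:E <= e%:E)%E.
Proof.
move=> f0 e0 foo.
have f0' i : (0 <= (f i)%:E)%E by rewrite lee_fin.
have fin : (\esum_(n in [set: int]) (f n)%:E)%E \is a fin_num.
  by rewrite ge0_fin_numE // esum_ge0.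
have [_ [X [finX _] <-] hX] := ub_ereal_sup_adherent e0 fin.
have [N XN] := finite_set_int finX; exists N.
have := esumID [set n : int | (absz n <= N)%N] [set: int] (fun n => (f n)%:E) (fun i _ => f0' i).
rewrite !setTI (_ : ~` _ = [set n : int | (N < absz n)%N]); last first.
  by apply/seteqP; split=> n /=; lia.
rewrite esum_ball // => E; rewrite E in fin *.
have : ((psum N f)%:E > \esum_(n in [set: int]) (f n)%:E - e%:E)%E.
  apply: (lt_le_trans hX); rewrite -esum_ball // -esum_fset //.
  exact: sub_esum.
rewrite E; case: (esum _ _) fin => [r||] //.
by rewrite -EFinD -EFinB lte_fin lee_fin; lra.
Qed.

Definition zsum a : R := limn (psum^~ a).

Definition abssum_le a (B : R) := forall N, psum N (fun j => `|a j|) <= B.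

Lemma abssum_cvg a B : abssum_le a B -> cvgn (psum^~ a).
Proof.
move=> aB.
have pos b C : (forall j, 0 <= b j) -> (forall N, psum N b <= C) -> cvgn (psum^~ b).
  move=> b0 bC; apply: nondecreasing_is_cvgn; first exact: psum_homo.
  by exists C => _ [N _ <-].
(* Both parts have nonnegative terms, so their partial sums are monotone and bounded. *)
have -> : psum^~ a = psum^~ (fun j => `|a j| + a j) - psum^~ (fun j => `|a j|).
  apply/funext => N; rewrite fctE /=.
  have := @psum_lin N 1 1 (fun j => `|a j|) a; rewrite !mul1r.
  have -> : psum N (fun j => 1 * `|a j| + 1 * a j) = psum N (fun j => `|a j| + a j).
    by apply: eq_psum => j _; rewrite !mul1r.
  by move=> ->; rewrite addrC addKr.
apply: is_cvgB; last by apply: (pos _ B).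
apply: (pos _ (B + B)) => [j|N]; first by have := ler_norm (- a j); rewrite normrN; lra.
apply: le_trans (lerD (aB N) (aB N)); rewrite /psum -big_split.
by apply: ler_sum => j _; rewrite lerD2l ler_norm.
Qed.

Lemma zsum_le a B : abssum_le a B -> `|zsum a| <= B.
Proof.
move=> aB; have c := abssum_cvg aB; rewrite /zsum -lim_norm //.
apply: limr_le; first exact: is_cvg_norm.
by near=> N; apply: le_trans (ler_norm_psum _ _) _; exact: aB.
Unshelve. all: by end_near. Qed.

Lemma zsum_lin (c d : R) a b A B : abssum_le a A -> abssum_le b B ->
  zsum (fun j => c * a j + d * b j) = c * zsum a + d * zsum b.
Proof.
move=> /abssum_cvg ca /abssum_cvg cb; apply: cvg_lim => //.
under eq_fun do rewrite psum_lin.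
by apply: cvgD; apply: cvgMr.
Qed.

Lemma zsum_finite N a : (forall j, (N < absz j)%N -> a j = 0) -> zsum a = psum N a.
Proof.
move=> a0; apply: lim_near_cst => //.
by exists N => // M /= NM; exact: psum_stable.
Qed.

Lemma eq_zsum a b : a =1 b -> zsum a = zsum b.
Proof. by move=> /funext ->. Qed.

Lemma abssum_esum a B : (\esum_(j in [set: int]) (`|a j|)%:E <= B%:E)%E ->
  abssum_le a B.
Proof.
by move=> h N; rewrite -lee_fin; apply: le_trans h; exact: psum_le_esum.
Qed.

End Sums.

(** * Exponentially decaying kernels on l^p *)

Section Lp.
Context {R : realType}.
Implicit Types (x y z : int -> R) (r q : R).

Definition lpsum r x : \bar R := (\esum_(n in [set: int]) (`|x n| `^ r)%:E)%E.

Lemma lpsum_ge0 r x : (0 <= lpsum r x)%E.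
Proof. by apply: esum_ge0 => n _; rewrite lee_fin powR_ge0. Qed.

Lemma in_lpP r x : 1 <= r -> in_lp r%:E x <-> (lpsum r x < +oo)%E.
Proof.
move=> r1; rewrite /in_lp /lpnorm -/(lpsum r x); split; last exact: poweR_lty.
have : r^-1 != 0 by rewrite invr_eq0; lra.
have := lpsum_ge0 r x; case: (lpsum r x) => [s| |] // _ r0; first by move=> _; exact: ltry.
by rewrite poweRyr.
Qed.

Lemma in_lp_bounded p x : (1%:E <= p)%E -> in_lp p x ->
  exists C : R, forall n, `|x n| <= C.
Proof.
case: p => [r| |] //.
  rewrite lee_fin => r1 /in_lpP -/(_ r1) xoo.
  have fin : lpsum r x \is a fin_num by rewrite ge0_fin_numE // lpsum_ge0.
  exists (fine (lpsum r x) `^ r^-1) => n.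
  have r0 : r != 0 by lra.
  have -> : `|x n| = (`|x n| `^ r) `^ r^-1 by rewrite -powRrM divff // powRr1.
  apply: ge0_ler_powR; rewrite ?nnegrE ?powR_ge0 ?invr_ge0 ?fine_ge0 ?lpsum_ge0 //; first by lra.
  rewrite -lee_fin fineK //.
  by apply: (@esum_term _ _ (fun n => (`|x n| `^ r)%:E)) => m; rewrite lee_fin powR_ge0.
move=> _; rewrite /in_lp /lpnorm => xoo.
have ub n : ((`|x n|)%:E <= ereal_sup (range (fun n => (`|x n|)%:E)))%E.
  by apply: ereal_sup_ubound; exists n.
exists (fine (ereal_sup (range (fun n => (`|x n|)%:E)))) => n.
rewrite -lee_fin fineK //; rewrite ge0_fin_numE //.
by apply: le_trans (ub 0); rewrite lee_fin.
Qed.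

Lemma lpnorm_infP x (C : R) :
  (lpnorm +oo%E x <= C%:E)%E <-> forall n, `|x n| <= C.
Proof.
split=> [h n|h]; last by apply: ge_ereal_sup => _ [n _ <-]; rewrite lee_fin.
by rewrite -lee_fin; apply: le_trans h; apply: ereal_sup_ubound; exists n.
Qed.

(** * Geometric kernels and a Young inequality *)

Section Geometric.
Context (q : R).
Hypothesis q01 : 0 < q < 1.
(** The sum of q^|k| over all integers k. *)
Local Notation S := ((1 + q) / (1 - q)).

Let q0 : 0 < q. Proof. by case/andP: q01. Qed.
Let q1 : q < 1. Proof. by case/andP: q01. Qed.

Let S_ge0 : 0 <= S.
Proof. by apply: divr_ge0; have := q0; have := q1; lra. Qed.

Lemma psum_geometric N : psum N (fun k => q ^+ absz k) <= S.
Proof.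
have -> : psum N (fun k => q ^+ absz k) = S - 2 * q ^+ N.+1 / (1 - q).
  have d0 : 1 - q != 0 by have := q1; lra.
  elim: N => [|N IH].
    by rewrite /psum big_ord1 subr0 expr0 expr1; field.
  by rewrite psumS IH abszN absz_nat !exprS; field.
by rewrite lerBlDr lerDl divr_ge0 ?mulr_ge0 ?exprn_ge0 ?subr_ge0 // ltW.
Qed.

Lemma esum_geometric i :
  (\esum_(j in [set: int]) (q ^+ absz (i - j))%:E <= S%:E)%E.
Proof.
rewrite -(@reindex_esum _ _ _ setT setT (fun j => i - j) (fun k => (q ^+ absz k)%:E)).
  apply: esum_le_psum => [j|N]; first by rewrite exprn_ge0 // ltW.
  by rewrite lee_fin psum_geometric.
split=> //= [j k _ _ /addrI /oppr_inj //|k _].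
by exists (i - k) => //; rewrite opprB addrC subrK.
Qed.

Lemma esum_geometric_bounded (C : R) (k : int -> R) i : 0 <= C ->
  (forall j, 0 <= k j <= C * q ^+ absz (i - j)) ->
  (\esum_(j in [set: int]) (k j)%:E <= (C * S)%:E)%E.
Proof.
move=> C0 kC.
apply: (@le_trans _ _ (\esum_(j in [set: int]) (C%:E * (q ^+ absz (i - j))%:E))%E).
  by apply: le_esum => j _; rewrite -EFinM lee_fin; case/andP: (kC j).
apply: le_trans (esumZ_le _ _ _) _ => // [j|]; first by rewrite lee_fin exprn_ge0 // ltW.
by rewrite EFinM lee_wpmul2l ?lee_fin // esum_geometric.
Qed.

(* Young's inequality for the exponentially decaying kernel.  Hoelder is
   avoided by [sum_j q^(2d) |z j| <= (sum_j q^d) * sup_j q^d |z j|], the [r]-th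
   power of the supremum being at most [sum_j q^d |z j|^r]. *)
Lemma young_geometric r (C : R) y z : 1 <= r -> 0 <= C ->
  (lpsum r z < +oo)%E ->
  (forall i, (`|y i|%:E <=
     \esum_(j in [set: int]) (C * q ^+ (2 * absz (i - j)) * `|z j|)%:E)%E) ->
  (lpsum r y <= ((C * S) `^ r * S)%:E * lpsum r z)%E.
Proof.
move=> r1 C0 zoo hy.
have r0 : r != 0 by lra.
have qd n : 0 <= q ^+ n by rewrite exprn_ge0 // ltW.
have qd1 n : 0 < q ^+ n <= 1 by rewrite exprn_gt0 // exprn_ile1 // ltW.
pose E i := (\esum_(j in [set: int]) (q ^+ absz (i - j) * `|z j| `^ r)%:E)%E.
have t0 i j : 0 <= q ^+ absz (i - j) * `|z j| `^ r by rewrite mulr_ge0 // powR_ge0.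
have E0 i : (0 <= E i)%E by apply: esum_ge0 => j _; rewrite lee_fin.
have Efin i : E i \is a fin_num.
  rewrite ge0_fin_numE //; apply: le_lt_trans zoo.
  apply: le_esum => j _; rewrite lee_fin ler_piMl ?powR_ge0 //.
  by case/andP: (qd1 (absz (i - j))).
have yE i : ((`|y i| `^ r)%:E <= ((C * S) `^ r)%:E * E i)%E.
  (* [M] dominates every q^|i-j| |z j|: for r >= 1 the r-th power of q^|i-j| is at most q^|i-j|, so
     the r-th power of the product is at most a single term of [E i]. *)
  set M := fine (E i) `^ r^-1.
  have M0 : 0 <= M by exact: powR_ge0.
  have MS : M `^ r = fine (E i) by rewrite -powRrM mulVf // powRr1 // fine_ge0.
  have zM j : q ^+ absz (i - j) * `|z j| <= M.
    have -> : q ^+ absz (i - j) * `|z j| = ((q ^+ absz (i - j) * `|z j|) `^ r) `^ r^-1.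
      by rewrite -powRrM divff // powRr1 // mulr_ge0.
    apply: ge0_ler_powR; rewrite ?nnegrE ?powR_ge0 ?fine_ge0 ?invr_ge0 //; first by lra.
    rewrite powRM //; apply: (@le_trans _ _ (q ^+ absz (i - j) * `|z j| `^ r)).
      by rewrite ler_wpM2r ?powR_ge0 // ge1r_powR.
    rewrite -lee_fin fineK //.
    by apply: (@esum_term _ _ (fun j => (q ^+ absz (i - j) * `|z j| `^ r)%:E)) => m; rewrite lee_fin.
  have yM : `|y i| <= C * S * M.
    rewrite -lee_fin mulrAC; apply: le_trans (hy i) _.
    apply: (@esum_geometric_bounded _ _ i); first by rewrite mulr_ge0.
    move=> j; rewrite !mulr_ge0 //= mulnC exprM expr2 -!mulrA ler_wpM2l //.
    by rewrite [leRHS]mulrC ler_wpM2l.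
  have CS0 : 0 <= C * S by rewrite mulr_ge0.
  rewrite -(fineK (Efin i)) -MS -EFinM lee_fin -powRM //.
  by apply: ge0_ler_powR; rewrite ?nnegrE //; [rewrite (le_trans ler01)|rewrite mulr_ge0].
apply: (@le_trans _ _ (\esum_(i in [set: int]) (((C * S) `^ r)%:E * E i))%E).
  by apply: le_esum => i _; exact: yE.
apply: le_trans (esumZ_le _ _ _) _; rewrite ?powR_ge0 //.
rewrite EFinM -muleA; apply: lee_wpmul2l; first by rewrite lee_fin powR_ge0.
rewrite /E esum_swap; last by move=> i j; rewrite lee_fin.
apply: (@le_trans _ _ (\esum_(j in [set: int]) (S%:E * (`|z j| `^ r)%:E))%E); last first.
  by apply: esumZ_le => // i; rewrite lee_fin powR_ge0.
apply: le_esum => j _; rewrite -EFinM mulrC.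
apply: (@esum_geometric_bounded _ _ j); first exact: powR_ge0.
by move=> i; rewrite t0 /= mulrC (_ : absz (i - j) = absz (j - i)) //; lia.
Qed.

End Geometric.
End Lp.

(** * Necessity *)

Section Necessity.
Context {R : realType}.

(* [s1^2 - t s0 s1 + s0^2 = (s1 - t/2 s0)^2 + (1 - t^2/4) s0^2] is invariant. *)
Lemma recurrence_decay (t : R) (s : nat -> R) : `|t| <= 2 ->
  (forall m, s m.+2 = t * s m.+1 - s m) -> s @ \oo --> (0 : R) -> s 0%N = 0.
Proof.
move=> t2 sS s0; have t2' : t ^+ 2 <= 4.
  by move: t2; rewrite ler_norml => /andP[h1 h2]; rewrite expr2; nra.
pose J m := s m.+1 ^+ 2 - t * s m * s m.+1 + s m ^+ 2.
have JS m : J m = J 0%N.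
  by elim: m => // m <-; rewrite /J sS; ring.
have s1 : (fun m => s m.+1) @ \oo --> (0 : R) by rewrite -(cvg_shiftS s) in s0.
have J0 m : J m = 0.
  rewrite JS.
  have cJ : J @ \oo --> (0 ^+ 2 - t * 0 * 0 + 0 ^+ 2 : R).
    by apply: cvgD; [apply: cvgB; [|apply: cvgM => //; exact: cvgMr]|]; rewrite ?expr2; apply: cvgM.
  have := @cvg_unique _ (@Rhausdorff R) _ _ _ _ cJ (_ : J @ \oo --> J 0%N).
  rewrite expr0n mulr0 subr0 addr0 => <- //.
  by rewrite (_ : J = fun=> J 0%N); [exact: cvg_cst|exact/funext].
have split m : (s m.+1 - t / 2 * s m) ^+ 2 = 0 /\ (1 - t ^+ 2 / 4) * s m ^+ 2 = 0.
  have := J0 m; rewrite /J => E.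
  have h1 := sqr_ge0 (s m.+1 - t / 2 * s m).
  have h2 : 0 <= (1 - t ^+ 2 / 4) * s m ^+ 2 by rewrite mulr_ge0 ?sqr_ge0 //; lra.
  have : (s m.+1 - t / 2 * s m) ^+ 2 + (1 - t ^+ 2 / 4) * s m ^+ 2 = 0.
    by rewrite -[RHS]E; field.
  by split; lra.
(* If t^2 < 4 the second square already gives s 0 = 0. If t^2 = 4, the first one gives s (m+1) =
   (t/2) s m, so s^2 is constant and tends to 0. *)
have [t4|t4] := eqVneq (t ^+ 2) 4; last first.
  have [_ /eqP] := split 0%N; rewrite mulf_eq0 sqrf_eq0 => /orP[/eqP h|/eqP //].
  by move/eqP: t4; lra.
have sq m : s m ^+ 2 = s 0%N ^+ 2.
  elim: m => // m <-; have [/eqP] := split m; rewrite sqrf_eq0 subr_eq0 => /eqP -> _.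
  by rewrite exprMn expr_div_n t4; field.
have c2 : (fun m => s m ^+ 2) @ \oo --> (0 * 0 : R).
  by under eq_fun do rewrite expr2; apply: cvgM.
have := @cvg_unique _ (@Rhausdorff R) _ _ _ _ c2
  (_ : (fun m => s m ^+ 2) @ \oo --> s 0%N ^+ 2).
rewrite mulr0 => h; apply/eqP; rewrite -sqrf_eq0 -h //.
by under eq_fun do rewrite sq; exact: cvg_cst.
Qed.

Lemma lp_decay (r : R) (y : int -> R) (e : R) : 1 <= r -> 0 < e ->
  in_lp r%:E y -> exists N : nat, forall n, (N < absz n)%N -> `|y n| <= e.
Proof.
move=> r1 e0 /in_lpP -/(_ r1) yoo.
have f0 j : 0 <= `|y j| `^ r by exact: powR_ge0.
have [N hN] := esum_tail f0 (powR_gt0 r e0) yoo.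
exists N => n Nn.
have h : `|y n| `^ r <= e `^ r.
  rewrite -lee_fin; apply: le_trans hN.
  rewrite -(@esum_set1 _ _ n (fun n => (`|y n| `^ r)%:E)) ?lee_fin //.
  by apply: sub_esum => [m /= -> //|m]; rewrite lee_fin.
have r0 : r != 0 by lra.
rewrite -[leLHS]powRr1 // -[leRHS]powRr1; last by lra.
rewrite -(divff r0) !powRrM.
by apply: ge0_ler_powR; rewrite ?nnegrE ?powR_ge0 ?invr_ge0 //; lra.
Qed.

Lemma lp_delta (r : R) : 1 <= r -> in_lp r%:E (fun n : int => (n == 0)%:R : R).
Proof.
move=> r1; apply/in_lpP => //; apply: (@le_lt_trans _ _ 1%:E); last exact: ltry.
apply: esum_le_psum => [j|N]; first exact: powR_ge0.
rewrite lee_fin (@eq_psum _ _ _ (fun j => (j == 0)%:R * 1)).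
  by rewrite psum_delta.
move=> j _; rewrite mulr1; case: eqP => _ /=; first by rewrite normr1 powR1.
by rewrite normr0 powR0 //; lra.
Qed.

(** For t^2 < 4 the invariant [J] is K-periodic in n and positive definite in (x n, x (n+K)), so it
    bounds every solution. For t^2 = 4 the double eigenvalue of M is t/2, which is 1 or -1: either y
    = (T - t/2) x, with T the shift by K, is a nonzero eigenvector, or x itself is one, and an
    eigenvector has periodic modulus. *)
Lemma bounded_solution (v : int -> R) (K : nat) : (0 < K)%N ->
  (forall n, v (n + K%:Z) = v n) -> `|\tr (monodromy v K)| <= 2 ->
  exists x, [/\ solution v x, exists C, forall n, `|x n| <= C & exists n, x n != 0].
Proof.
move=> K0 vK; set t := \tr _ => t2.
have t2' : t ^+ 2 <= 4.
  by move: t2; rewrite ler_norml => /andP[h1 h2]; rewrite expr2; nra.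
pose x := sol v 1 0; have hx : solution v x by exact: sol_solution.
have F n : x (n + K%:Z + K%:Z) = t * x (n + K%:Z) - x n by exact: floquet.
have [t4|t4] := eqVneq (t ^+ 2) 4; last first.
  exists x; split=> //; last by exists 0; rewrite /x sol0 oner_neq0.
  pose J n := x (n + K%:Z) ^+ 2 - t * x n * x (n + K%:Z) + x n ^+ 2.
  have [C [C0 JC]] : exists C, 0 < C /\ forall n, `|J n| <= C.
    by apply: (@periodic_bounded _ K) => // n; rewrite /J F; ring.
  have d0 : 0 < 1 - t ^+ 2 / 4 by move/eqP: t4; lra.
  exists (1 + C / (1 - t ^+ 2 / 4)) => n.
  have B : x n ^+ 2 <= C / (1 - t ^+ 2 / 4).
    rewrite ler_pdivlMr //; apply: le_trans (JC n); apply: le_trans (ler_norm _).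
    have : J n = (x (n + K%:Z) - t / 2 * x n) ^+ 2 + x n ^+ 2 * (1 - t ^+ 2 / 4).
      by rewrite /J; field.
    by move=> ->; rewrite lerDr sqr_ge0.
  apply: le_trans (_ : 1 + x n ^+ 2 <= _); last by rewrite lerD2l.
  by rewrite -real_normK ?num_real //; have := sqr_ge0 (`|x n| - 1); rewrite !expr2; nra.
have per (y : int -> R) : (forall n, y (n + K%:Z) = t / 2 * y n) ->
    exists C, forall n, `|y n| <= C.
  move=> hy; have t1 : `|t / 2| = 1.
    apply/eqP; rewrite -(@eqrXn2 _ 2) // ?expr1n // real_normK ?num_real //.
    by rewrite expr_div_n t4; apply/eqP; field.
  have yK n : `|y (n + K%:Z)| = `|y n| by rewrite hy normrM t1 mul1r.
  have [C [_ hC]] := periodic_bounded K0 yK.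
  by exists C => n; rewrite -[leLHS]normr_id.
pose y n := 1 * x (n + K%:Z) + - (t / 2) * x n.
have hy : solution v y by apply: solution_lin => //; exact: solution_period.
have py n : y (n + K%:Z) = t / 2 * y n.
  apply/eqP; rewrite -subr_eq0 /y F; apply/eqP.
  by transitivity ((t ^+ 2 / 4 - 1) * x n); [field|rewrite t4; field].
have [[n yn]|N] := pselect (exists n, y n != 0).
  by exists y; split=> //; [exact: per|exists n].
exists x; split=> //; last by exists 0; rewrite /x sol0 oner_neq0.
apply: per => n; move/forallNP : N => /(_ n) /negP; rewrite negbK /y => /eqP; lra.
Qed.

Lemma lp_invertible_trace (p : \bar R) (v : int -> R) (K : nat) Ainv :
  (1%:E <= p)%E -> (0 < K)%N -> (forall n, v (n + K%:Z) = v n) ->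
  lp_inverse p (schrod v) Ainv -> 2 < `|\tr (monodromy v K)|.
Proof.
move=> p1 K0 vK inv; rewrite ltNge; apply/negP; set t := \tr _ => t2.
case: p p1 inv => [r| |] // p1 inv; last first.
  (* For p = oo the bounded solution and 0 have the same image, so the left inverse identifies
     them. *)
  have [x [hx [C xC] [n /negP]]] := bounded_solution K0 vK t2; apply; apply/eqP.
  have xlp : in_lp +oo%E x.
    by apply: (@le_lt_trans _ _ C%:E); [apply/lpnorm_infP|exact: ltry].
  have olp : in_lp +oo%E (fun=> 0 : R).
    by apply: (@le_lt_trans _ _ 0%:E); [apply/lpnorm_infP => m; rewrite normr0|exact: ltry].
  have [_ _ ex] := inv _ xlp; have [_ _ eo] := inv _ olp.
  suff -> : x = fun=> 0 by [].
  rewrite -[LHS]ex -[RHS]eo; congr (Ainv _).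
  by apply/funext => m; rewrite hx /schrod mulr0 !addr0.
rewrite lee_fin in p1.
have [ylp hy _] := inv _ (lp_delta p1); set y := Ainv _ in ylp hy.
have K1 (m : nat) : m%:Z <= m%:Z * K%:Z by rewrite ler_peMr //; lia.
have cvg0 (g : nat -> int) : (forall m : nat, (m <= absz (g m))%N) ->
    (fun m => y (g m)) @ \oo --> (0 : R).
  move=> gm; apply/cvgrPdist_le => e e0.
  have [N hN] := lp_decay p1 e0 ylp; exists N.+1 => // m /= Nm.
  by rewrite sub0r normrN hN // (leq_trans Nm).
have yR n : 0 <= n -> y n = 0.
  (* The value at -1 is chosen so that x 1 = y 1; it need not equal y (-1), since y fails the
     homogeneous equation at 0. *)
  pose x := sol v (y 0) (- v 0 * y 0 - y 1).
  have hx : solution v x by exact: sol_solution.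
  have E : forall n, 0 <= n -> y n = x n.
    apply: (@right_eq _ v).
    - by move=> m m0; rewrite hy hx; case: eqP => //; lia.
    - by rewrite /x sol0.
    - have := solutionS hx 0; rewrite add0r sub0r /x solN1 sol0 => ->; ring.
  move=> n0; rewrite E //.
  have := @recurrence_decay t (fun m => x (n + m%:Z * K%:Z)) t2.
  rewrite mul0r addr0; apply.
    move=> m; have := floquet vK hx (n + m%:Z * K%:Z); rewrite -/t.
    by rewrite -(addn1 m.+1) -(addn1 m) !PoszD !mulrDl !mul1r !addrA.
  rewrite (_ : (fun m => _) = (fun m : nat => y (n + m%:Z * K%:Z))).
    by apply: cvg0 => m; have := K1 m; lia.
  by apply/funext => m; rewrite E //; have := K1 m; lia.
have yL n : n <= 0 -> y n = 0.
  pose x := sol v (y 0) (y (- 1)).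
  have hx : solution v x by exact: sol_solution.
  have E : forall n, n <= 0 -> y n = x n.
    apply: (@left_eq _ v).
    - by move=> m m0; rewrite hy hx; case: eqP => //; lia.
    - by rewrite /x sol0.
    - by rewrite sub0r /x solN1.
  move=> n0; rewrite E //.
  have := @recurrence_decay t (fun m => x (n - m%:Z * K%:Z)) t2.
  rewrite mul0r subr0; apply.
    move=> m; have := floquet vK hx (n - m.+2%:Z * K%:Z); rewrite -/t.
    have -> : n - m.+2%:Z * K%:Z + K%:Z = n - m.+1%:Z * K%:Z.
      by rewrite -(addn1 m.+1) PoszD mulrDl mul1r; ring.
    have -> : n - m.+1%:Z * K%:Z + K%:Z = n - m%:Z * K%:Z.
      by rewrite -(addn1 m) PoszD mulrDl mul1r; ring.
    by lra.
  rewrite (_ : (fun m => _) = (fun m : nat => y (n - m%:Z * K%:Z))).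
    by apply: cvg0 => m; have := K1 m; lia.
  by apply/funext => m; rewrite E //; have := K1 m; lia.
have := congr1 (fun g : int -> R => g 0) hy; rewrite /schrod eqxx add0r sub0r.
by rewrite (yR 1) // (yL (- 1)) // (yR 0) // mulr0 !addr0 => /esym/eqP; rewrite oner_eq0.
Qed.

End Necessity.

(** * Green kernels *)

Section Green.
Context {R : realType}.
Implicit Types (v e f g x : int -> R) (i j : int).

Definition wronskian f e : R := f 0 * e 1 - f 1 * e 0.

(** The same formula serves H, with solutions decaying at -oo and +oo, and the finite section, with
    solutions vanishing at -(n+1) and n+1. *)
Definition green f e i j : R :=
  (if i <= j then f i * e j else f j * e i) / wronskian f e.

Lemma green_le f e i j : i <= j -> green f e i j = f i * e j / wronskian f e.
Proof. by rewrite /green => ->. Qed.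

Lemma green_ge f e i j : j <= i -> green f e i j = f j * e i / wronskian f e.
Proof.
by rewrite /green le_eqVlt => /orP[/eqP ->|]; [rewrite lexx|rewrite ltNge => /negPf ->].
Qed.

Lemma greenC f e i j : green f e i j = green f e j i.
Proof.
have [ij|/ltW ji] := leP i j; first by rewrite green_le // green_ge.
by rewrite green_ge // green_le.
Qed.

(** Away from the diagonal a column is locally a multiple of [f] or of [e]; on the diagonal the
    mismatch is the Wronskian, which the normalization turns into 1. *)
Lemma schrod_green v f e j : solution v f -> solution v e ->
  wronskian f e != 0 ->
  forall i, schrod v (green f e ^~ j) i = (i == j)%:R.
Proof.
move=> hf he w0 i.
have W : f j * e (j + 1) - f (j + 1) * e j = wronskian f e.
  by rewrite (wronskian_const hf he j 0) add0r.
rewrite /schrod /=; have [ij|ij|->] := ltgtP i j.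
- rewrite !green_le; [|lia|lia|lia].
  by rewrite (solutionS hf i) /=; ring.
- rewrite !green_ge; [|lia|lia|lia].
  by rewrite (solutionS he i) /=; ring.
- rewrite green_ge; last lia.
  rewrite !green_le //; last lia.
  rewrite -[RHS](divff w0) -{4}W (solutionP hf j); ring.
Qed.

(** Truncating a tridiagonal row loses at most an entry at n+1 or -(n+1), where [g] vanishes. *)
Lemma psum_schrod_mx v g n i : g (- n.+1%:Z) = 0 -> g n.+1%:Z = 0 ->
  (absz i <= n)%N -> psum n (fun j => schrod_mx v i j * g j) = schrod v g i.
Proof.
move=> gl gr iN.
have -> : psum n (fun j => schrod_mx v i j * g j) =
    psum n (fun j => 1 * (1 * ((j == i + 1)%:R * g j) + 1 * ((j == i - 1)%:R * g j)) +
                     v i * ((j == i)%:R * g j)).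
  apply: eq_psum => j _; rewrite /schrod_mx.
  case: eqP => [->|j1] /=.
    have -> : (i + 1 == i - 1) = false by lia.
    have -> : (i + 1 == i) = false by lia.
    by rewrite /=; ring.
  case: eqP => [->|j2] /=.
    have -> : (i - 1 == i) = false by lia.
    by rewrite /=; ring.
  by case: eqP => _ /=; ring.
rewrite !psum_lin !psum_delta iN !mul1r /schrod; congr (_ + _ + _).
  by case: ifPn => // ?; have -> : i + 1 = n.+1%:Z by lia.
by case: ifPn => // ?; have -> : i - 1 = - n.+1%:Z by lia.
Qed.

(** * The inverse of a finite section *)

Section FiniteSection.
Context (v f e : int -> R) (n : nat).
Hypothesis hf : solution v f.
Hypothesis he : solution v e.
Hypothesis w0 : wronskian f e != 0.
Hypothesis fl : f (- n.+1%:Z) = 0.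
Hypothesis er : e n.+1%:Z = 0.

Let B : 'M[R]_(n.*2.+1) :=
  \matrix_(i, j) green f e (i%:Z - n%:Z) (j%:Z - n%:Z).

Lemma fsection_mul_green : fsection (schrod_mx v) n *m B = 1%:M.
Proof.
apply/matrixP => i k; rewrite !mxE.
have -> : \sum_j fsection (schrod_mx v) n i j * B j k =
    psum n (fun j => schrod_mx v (i%:Z - n%:Z) j * green f e j (k%:Z - n%:Z)).
  by apply: eq_bigr => j _; rewrite !mxE.
have := ltn_ord i; have := ltn_ord k => ik kk.
rewrite psum_schrod_mx //; last lia.
- rewrite schrod_green //; congr (_%:R); congr nat_of_bool.
  by apply/eqP/eqP => [h|-> //]; apply: val_inj => /=; lia.
- by rewrite green_le ?fl ?mul0r //; lia.
- by rewrite green_ge ?er ?mulr0 ?mul0r //; lia.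
Qed.

Lemma fsection_unit : fsection (schrod_mx v) n \in unitmx.
Proof. by have [] := mulmx1_unit fsection_mul_green. Qed.

Lemma fsection_inv_green x i : fsection_inv (schrod_mx v) n x i =
  if (absz i <= n)%N then psum n (fun j => green f e i j * x j) else 0.
Proof.
have inv : invmx (fsection (schrod_mx v) n) = B.
  by rewrite -[RHS](mulKmx fsection_unit) fsection_mul_green mulmx1.
rewrite /fsection_inv; have -> : (- n%:Z <= i <= n%:Z) = (absz i <= n)%N by lia.
case: ifPn => // iN; apply: eq_bigr => j _; rewrite inv mxE inordK; last lia.
by congr (green _ _ _ _ * _); lia.
Qed.

End FiniteSection.

(** The right-hand sides are the exponents of q in the bounds for alpha e_i e_j, beta f_i f_j, alpha
    beta e_i f_j and alpha beta f_i e_j, where e and f decay at rate q^4 and [m] is the exponent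
    contributed by each of alpha and beta. [N] combines the factor q^(2|i-j|) demanded by the Young
    inequality with the depth of the more central index inside [-n,n]. *)
Lemma section_exponents (n : nat) i j : i <= j -> (absz i <= n)%N -> (absz j <= n)%N ->
  let N := ((2 * absz (i - j) + (n - minn (absz i) (absz j)))%N)%:Z in
  let m := 2 * n.+1%:Z in
  [/\ N <= 4 * (m + (i + j)), N <= 4 * (m + (- i + - j)),
      N <= 4 * (m + m + (i + - j)) & N <= 4 * (m + m + (- i + j))].
Proof.
move=> ij iN jN N m.
have -> : m = 2 * n%:Z + 2 by rewrite /m; lia.
have d : (absz (i - j))%:Z = j - i by lia.
have k1 : ((n - minn (absz i) (absz j))%N)%:Z <= n%:Z + j by lia.
have k2 : ((n - minn (absz i) (absz j))%N)%:Z <= n%:Z - i by lia.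
have NE : N = 2 * (j - i) + ((n - minn (absz i) (absz j))%N)%:Z by rewrite /N PoszD PoszM d.
have iN' : - n%:Z <= i by lia.
have jN' : j <= n%:Z by lia.
move: NE k1 k2 iN' jN' ij; move: N ((n - _)%N)%:Z n%:Z; clear.
by move=> N k n -> *; split; lia.
Qed.

(** With one index outside [-n,n], the (truncated) depth of the other is at most j - i, so the left
    side is at most 3 (j - i). *)
Lemma outside_exponent (n : nat) i j : i <= j -> ~~ ((absz i <= n)%N && (absz j <= n)%N) ->
  ((2 * absz (i - j) + (n - minn (absz i) (absz j)))%N)%:Z <= 4 * (- i + j).
Proof.
move=> ij out.
have d : (absz (i - j))%:Z = j - i by lia.
have k : ((n - minn (absz i) (absz j))%N)%:Z <= j - i by lia.
by rewrite PoszD PoszM d; lia.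
Qed.

(** * Comparison of the Green kernels of the section and of H *)

Section Decay.
Context (q : R).
Hypothesis q01 : 0 < q < 1.
Local Notation rho := (q ^+ 4).

Lemma rho_le (N : nat) (z : int) : N%:Z <= 4 * z -> rho ^ z <= q ^+ N.
Proof.
case/andP: q01 => q0 q1.
case: z => [k|k] h; last by lia.
by rewrite -exprnP -exprM; apply: ler_wiXn2l; [exact: ltW|exact: ltW|lia].
Qed.

Lemma norm_mul_le (a b A B : R) (y z : int) :
  `|a| <= A * rho ^ y -> `|b| <= B * rho ^ z ->
  `|a * b| <= A * B * rho ^ (y + z).
Proof.
move=> ha hb; rewrite normrM expfzDr; last first.
  by case/andP: q01 => q0 _; rewrite expf_neq0 // gt_eqF.
rewrite mulrACA; exact: ler_pM.
Qed.

Context (C : R) (e f : int -> R).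
Hypothesis C1 : 1 <= C.
Hypothesis e_le : forall n : int, `|e n| <= C * rho ^ n.
Hypothesis f_le : forall n : int, `|f n| <= C * rho ^ (- n).
Hypothesis eV_le : forall n : int, `|(e n)^-1| <= C * rho ^ (- n).
Hypothesis fV_le : forall n : int, `|(f n)^-1| <= C * rho ^ n.
Local Notation w := (wronskian f e).
Hypothesis w0 : w != 0.

(* [phi = f - alpha e] vanishes at [-(n+1)], [psi = e - beta f] at [n+1]. *)
Definition alpha (n : nat) : R := f (- n.+1%:Z) * (e (- n.+1%:Z))^-1.
Definition beta (n : nat) : R := e n.+1%:Z * (f n.+1%:Z)^-1.
Definition phi n i : R := 1 * f i + - alpha n * e i.
Definition psi n i : R := 1 * e i + - beta n * f i.

Lemma alpha_le n : `|alpha n| <= C * C * rho ^ (2 * n.+1%:Z).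
Proof.
have -> : 2 * n.+1%:Z = - - n.+1%:Z + - - n.+1%:Z by rewrite opprK -mulr2n mulr_natl.
exact: norm_mul_le.
Qed.

Lemma beta_le n : `|beta n| <= C * C * rho ^ (2 * n.+1%:Z).
Proof.
have -> : 2 * n.+1%:Z = n.+1%:Z + n.+1%:Z by rewrite -mulr2n mulr_natl.
exact: norm_mul_le.
Qed.

Lemma wronskian_phi_psi n :
  wronskian (phi n) (psi n) = w * (1 - alpha n * beta n).
Proof. by rewrite /wronskian /phi /psi; ring. Qed.

Definition section_kernel n i j : R :=
  if (absz i <= n)%N && (absz j <= n)%N then green (phi n) (psi n) i j else 0.

(** Inside the square the difference is a sum of four products, each containing alpha or beta;
    outside it is the kernel of H, small because i and j are far apart. The power C^6 comes from
    alpha beta (C^4) times two solution values, and 8 from four terms over a denominator |1 - alpha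
    beta| >= 1/2. *)
Lemma section_kernel_diff n i j : `|alpha n * beta n| <= 2^-1 ->
  `|section_kernel n i j - green f e i j| <=
    8 * C ^+ 6 / `|w| * q ^+ (2 * absz (i - j) + (n - minn (absz i) (absz j)))%N.
Proof.
move=> ab; case/andP: q01 => q0 q1.
wlog ij : i j / i <= j => [H|].
  have [ij|/ltW ji] := leP i j; first exact: H.
  rewrite /section_kernel greenC (greenC f) andbC minnC.
  have -> : absz (i - j) = absz (j - i) by lia.
  by exact: H.
set N := (_ + _)%N.
have W0 : 0 < `|w| by rewrite normr_gt0.
have qN : 0 <= q ^+ N by rewrite exprn_ge0 // ltW.
have C0 : 0 <= C by exact: le_trans C1.
have C4 : C ^+ 4 <= C ^+ 6 by apply: ler_weXn2l.
have C2 : C ^+ 2 <= C ^+ 6 by apply: ler_weXn2l.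
have up (a A : R) (z : int) : `|a| <= A * rho ^ z -> N%:Z <= 4 * z ->
    A <= C ^+ 6 -> 0 <= A -> `|a| <= C ^+ 6 * q ^+ N.
  move=> h1 /rho_le h2 h3 h4; apply: le_trans h1 _; apply: ler_pM => //.
  by apply: exprz_ge0; rewrite exprn_ge0 // ltW.
have H0 := norm_mul_le (f_le i) (e_le j).
rewrite /section_kernel; case: ifPn => [/andP[iN jN]|out].
  have d0 : 1 - alpha n * beta n != 0.
    rewrite subr_eq0; apply: contraTneq ab => <-.
    by rewrite normr1 -ltNge invf_lt1 // ltr1n.
  have [z1 z2 z3 z4] := section_exponents ij iN jN.
  rewrite !green_le // wronskian_phi_psi.
  have -> : phi n i * psi n j / (w * (1 - alpha n * beta n)) - f i * e j / w =
    (- (alpha n * (e i * e j)) - beta n * (f i * f j) + alpha n * beta n * (e i * f j)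
      + alpha n * beta n * (f i * e j)) / (w * (1 - alpha n * beta n)).
    by rewrite /phi /psi; field; rewrite w0 d0.
  have T1 : `|alpha n * (e i * e j)| <= C ^+ 6 * q ^+ N.
    apply: (up _ _ _ (norm_mul_le (alpha_le n) (norm_mul_le (e_le i) (e_le j)))); [exact: z1| |].
      by rewrite -!expr2 -exprM // -exprD.
    by rewrite !mulr_ge0.
  have T2 : `|beta n * (f i * f j)| <= C ^+ 6 * q ^+ N.
    apply: (up _ _ _ (norm_mul_le (beta_le n) (norm_mul_le (f_le i) (f_le j)))); [exact: z2| |].
      by rewrite -!expr2 -exprM // -exprD.
    by rewrite !mulr_ge0.
  have ABle := norm_mul_le (alpha_le n) (beta_le n).
  have T3 : `|alpha n * beta n * (e i * f j)| <= C ^+ 6 * q ^+ N.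
    apply: (up _ _ _ (norm_mul_le ABle (norm_mul_le (e_le i) (f_le j)))); [exact: z3| |].
      by rewrite -!expr2 -exprM // -!exprD.
    by rewrite !mulr_ge0.
  have T4 : `|alpha n * beta n * (f i * e j)| <= C ^+ 6 * q ^+ N.
    apply: (up _ _ _ (norm_mul_le ABle H0)); [exact: z4| |].
      by rewrite -!expr2 -exprM // -!exprD.
    by rewrite !mulr_ge0.
  rewrite normrM normfV normrM.
  have D2 : 2^-1 <= `|1 - alpha n * beta n|.
    have := lerB_normD 1 (- (alpha n * beta n)); rewrite normr1 normrN; lra.
  have -> : 8 * C ^+ 6 / `|w| * q ^+ N = 4 * (C ^+ 6 * q ^+ N) / (`|w| / 2).
    by field; lra.
  apply: ler_pM; rewrite ?invr_ge0 ?mulr_ge0 //.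
  - apply: le_trans (ler_normD _ _) _; apply: le_trans (lerD (ler_normD _ _) (lexx _)) _.
    apply: le_trans (lerD (lerD (ler_normB _ _) (lexx _)) (lexx _)) _.
    by rewrite normrN; lra.
  - rewrite lef_pV2 ?posrE //; first by rewrite ler_pM2l.
      by rewrite mulr_gt0 //; lra.
    by rewrite divr_gt0.
rewrite sub0r normrN green_le // normrM normfV.
have := up _ _ _ H0; rewrite -expr2 => T.
have {T} T : `|f i * e j| <= C ^+ 6 * q ^+ N.
  by apply: T; [exact: outside_exponent|exact: C2|rewrite exprn_ge0].
have : `|f i * e j| / `|w| <= C ^+ 6 * q ^+ N / `|w| by rewrite ler_pM2r // invr_gt0.
move=> /le_trans; apply; rewrite mulrAC ler_wpM2r // ler_wpM2r ?invr_ge0 //.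
have := exprn_ge0 6 C0; lra.
Qed.

(** The generous constant is the one of [section_kernel_diff], so that a single constant serves both
    kernels. *)
Lemma green_decay i j :
  `|green f e i j| <= 8 * C ^+ 6 / `|w| * q ^+ (2 * absz (i - j))%N.
Proof.
case/andP: q01 => q0 q1; have C0 : 0 <= C by exact: le_trans C1.
wlog ij : i j / i <= j => [H|].
  have [ij|/ltW ji] := leP i j; first exact: H.
  rewrite greenC (_ : absz (i - j) = absz (j - i)); last by lia.
  exact: H.
have H0 := norm_mul_le (f_le i) (e_le j).
have H1 : rho ^ (- i + j) <= q ^+ (2 * absz (i - j)) by apply: rho_le; lia.
have C2 : C * C <= 8 * C ^+ 6.
  rewrite -expr2; have : C ^+ 2 <= C ^+ 6 by exact: ler_weXn2l.
  by have := exprn_ge0 6 C0; lra.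
rewrite green_le // normrM normfV mulrAC ler_wpM2r ?invr_ge0 //.
apply: le_trans H0 _; apply: ler_pM => //; first by rewrite mulr_ge0.
by apply: exprz_ge0; rewrite exprn_ge0 // ltW.
Qed.

End Decay.
End Green.

(** * The Floquet basis *)

Section Basis.
Context {R : realType}.

Lemma hyperbolic_root (t : R) : 2 < `|t| ->
  exists mu : R, [/\ mu != 0, `|mu| < 1 & t = mu + mu^-1].
Proof.
wlog t0 : t / 0 <= t => [H|].
  have [/H //|/ltW t0] := leP 0 t.
  rewrite -normrN; case/H; first by rewrite oppr_ge0.
  move=> mu [mu0 mu1 tE]; exists (- mu); split; rewrite ?oppr_eq0 ?normrN //.
  by rewrite invrN -opprD -tE opprK.
rewrite ger0_norm // => t2.
pose s := Num.sqrt (t ^+ 2 - 4).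
have ss : s ^+ 2 = t ^+ 2 - 4 by rewrite sqr_sqrtr // expr2; nra.
have s0 : 0 <= s by exact: sqrtr_ge0.
have nu1 : 1 < (t + s) / 2 by lra.
have nu0 : (t + s) / 2 != 0 by lra.
(* The roots of X^2 - tX + 1 have product 1; mu is the inverse of the larger one. *)
exists ((t + s) / 2)^-1; split.
- by rewrite invr_eq0.
- by rewrite normfV invf_lt1 ger0_norm //; lra.
- rewrite invrK.
  have -> : ((t + s) / 2)^-1 = (t - s) / 2.
    apply: (mulfI nu0); rewrite divff //.
    have -> : (t + s) / 2 * ((t - s) / 2) = (t ^+ 2 - s ^+ 2) / 4 by field.
    by rewrite ss; field.
  by field.
Qed.

(** The function |x n| b^(-n) is K-periodic, hence bounded. *)
Lemma quasiperiodic_bounded (K : nat) (x : int -> R) (nu b : R) : (0 < K)%N ->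
  0 < b -> `|nu| = b ^+ K -> (forall n, x (n + K%:Z) = nu * x n) ->
  exists C, 1 <= C /\ forall n, `|x n| <= C * b ^ n.
Proof.
move=> K0 b0 nuE xK.
have bn0 : b != 0 by rewrite gt_eqF.
have per n : `|x (n + K%:Z)| * b ^ (- (n + K%:Z)) = `|x n| * b ^ (- n).
  rewrite xK normrM nuE opprD expfzDr // -exprnN; field.
  by rewrite expf_neq0.
have [C [C0 hC]] := periodic_bounded K0 per.
exists (1 + C); split; first by rewrite lerDl ltW.
move=> n; have bz : 0 < b ^ n by exact: exprz_gt0.
have h : `|x n| / b ^ n <= C.
  by apply: le_trans (hC n); rewrite invr_expz ler_norm.
rewrite ler_pdivrMr // in h; apply: le_trans h _.
by rewrite ler_pM2r // lerDr ler01.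
Qed.

Lemma root_exists (a : R) (n : nat) : (0 < n)%N -> 0 < a < 1 ->
  exists q : R, 0 < q < 1 /\ q ^+ n = a.
Proof.
move=> n0 /andP[a0 a1]; have n0' : n%:R != 0 :> R by rewrite pnatr_eq0 -lt0n.
exists (a `^ n%:R^-1).
have qE : (a `^ n%:R^-1) ^+ n = a.
  by rewrite -powR_mulrn ?powR_ge0 // -powRrM mulVf // powRr1 // ltW.
split=> //; rewrite powR_gt0 //= ltNge; apply/negP => q1.
by move: a1; rewrite -qE ltNge exprn_ege1.
Qed.

(** A zero at j recurs at j+K, so the first hypothesis gives nu^2 x(j+1)^2 = x(j+1)^2; then x(j+1) =
    0 as well and x vanishes identically. *)
Lemma quasiperiodic_neq0 (v x : int -> R) (K : nat) (nu : R) :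
  (forall x j, solution v x -> x j = 0 -> x (j + K%:Z) = 0 ->
    x (j + 1 + K%:Z) ^+ 2 = x (j + 1) ^+ 2) ->
  nu ^+ 2 != 1 -> solution v x -> (forall n, x (n + K%:Z) = nu * x n) ->
  (exists n, x n != 0) -> forall n, x n != 0.
Proof.
move=> dir nu1 hx xK [m xm] j; apply/eqP => xj.
have := dir x j hx xj; rewrite xK xj mulr0 => /(_ erefl).
rewrite xK exprMn => /eqP; rewrite -subr_eq0 -{2}[x (j + 1) ^+ 2]mul1r -mulrBl.
rewrite mulf_eq0 subr_eq0 (negPf nu1) /= sqrf_eq0 => /eqP xj1.
by move: xm; rewrite (solution_eq0 hx xj xj1) eqxx.
Qed.

Lemma floquet_basis (v : int -> R) (K : nat) : (0 < K)%N ->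
  (forall n, v (n + K%:Z) = v n) ->
  (forall x j, solution v x -> x j = 0 -> x (j + K%:Z) = 0 ->
    x (j + 1 + K%:Z) ^+ 2 = x (j + 1) ^+ 2) ->
  2 < `|\tr (monodromy v K)| ->
  exists (q C : R) (e f : int -> R),
    [/\ [/\ 0 < q < 1, 1 <= C, solution v e & solution v f],
        wronskian f e != 0 /\ (forall n, e n != 0) /\ (forall n, f n != 0),
        (forall n, `|e n| <= C * (q ^+ 4) ^ n) /\
        (forall n, `|f n| <= C * (q ^+ 4) ^ (- n)),
        (forall n, `|(e n)^-1| <= C * (q ^+ 4) ^ (- n)) &
        (forall n, `|(f n)^-1| <= C * (q ^+ 4) ^ n)].
Proof.
move=> K0 vK dir /hyperbolic_root[mu [mu0 mu1 tE]].
have mu01 : 0 < `|mu| < 1 by rewrite normr_gt0 mu0.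
have musq : mu ^+ 2 != 1.
  by rewrite -real_normK ?num_real // lt_eqF // exprn_ilt1.
have musqV : mu^-1 ^+ 2 != 1 by rewrite exprVn invr_eq1.
have [e [he eK en0]] := floquet_exists vK mu0 musq tE.
have tE' : \tr (monodromy v K) = mu^-1 + mu^-1^-1 by rewrite invrK addrC.
have muV0 : mu^-1 != 0 by rewrite invr_eq0.
have [f [hf fK fn0]] := floquet_exists vK muV0 musqV tE'.
have e0 := quasiperiodic_neq0 dir musq he eK en0.
have f0 := quasiperiodic_neq0 dir musqV hf fK fn0.
have K4 : (0 < 4 * K)%N by rewrite muln_gt0.
(* With q^(4K) = |mu|, the Floquet solutions decay at rate q^4 per step. *)
have [q [q01 qE]] := root_exists K4 mu01.
have q0 : 0 < q by case/andP: q01.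
have r0 : 0 < q ^+ 4 by rewrite exprn_gt0.
have rV0 : 0 < (q ^+ 4)^-1 by rewrite invr_gt0.
have muE : `|mu| = (q ^+ 4) ^+ K by rewrite -exprM.
have muVE : `|mu^-1| = (q ^+ 4)^-1 ^+ K by rewrite normfV muE exprVn.
have [C1 [C1_1 H1]] := quasiperiodic_bounded K0 r0 muE eK.
have [C2 [C2_1 H2]] := quasiperiodic_bounded K0 rV0 muVE fK.
(* Reciprocals are multiplied by the inverse constant over a period, so they obey the same kind of
   bound. *)
have eVK n : (e (n + K%:Z))^-1 = mu^-1 * (e n)^-1 by rewrite eK invfM.
have [C3 [C3_1 H3]] := quasiperiodic_bounded K0 rV0 muVE eVK.
have fVK n : (f (n + K%:Z))^-1 = mu * (f n)^-1 by rewrite fK invfM invrK.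
have [C4 [C4_1 H4]] := quasiperiodic_bounded K0 r0 muE fVK.
have up (c a : R) : 0 <= a -> c <= C1 + C2 + C3 + C4 -> c * a <= (C1 + C2 + C3 + C4) * a.
  by move=> a0 h; rewrite ler_wpM2r.
have rz (z : int) : 0 <= (q ^+ 4) ^ z by rewrite ltW // exprz_gt0.
exists q, (C1 + C2 + C3 + C4), e, f; split.
- by split=> //; lra.
- split; last by split.
  (* A zero Wronskian makes f a multiple of e; the multipliers mu and mu^-1 then agree and mu^2 =
     1. *)
  apply/negP; rewrite /wronskian => /eqP W.
  have fe : f =1 (fun n => f 0 / e 0 * e n + 0 * e n).
    apply: (@solution_eq _ v _ _ 0) => //; first exact: solution_lin.
      by field.
    rewrite add0r mul0r addr0 -mulrA mulrCA.
    have -> : f 0 * e 1 = f 1 * e 0 by lra.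
    by rewrite mulrCA mulVf // mulr1.
  have h1 := fK 0; rewrite add0r in h1; have h2 := eK 0; rewrite add0r in h2.
  move: (fe K%:Z); rewrite h1 h2 mul0r addr0.
  have -> : f 0 / e 0 * (mu * e 0) = mu * f 0 by field.
  move=> /(mulIf (f0 0)) h; move: musq; rewrite expr2 -{1}h mulVf //.
  by rewrite eqxx.
- split=> n; first by apply: le_trans (H1 n) _; apply: up => //; lra.
  by apply: le_trans (H2 n) _; rewrite exprz_inv; apply: up => //; lra.
- by move=> n; apply: le_trans (H3 n) _; rewrite exprz_inv; apply: up => //; lra.
- by move=> n; apply: le_trans (H4 n) _; apply: up => //; lra.
Qed.

End Basis.

(** * Sufficiency *)

Section Convergence.
Context {R : realType}.

Definition bounded_seq (x : int -> R) := exists X : R, forall n, `|x n| <= X.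

Lemma zsum_le_esum (a : int -> R) :
  (`|zsum a|%:E <= \esum_(j in [set: int]) `|a j|%:E)%E.
Proof.
have : (0 <= \esum_(j in [set: int]) `|a j|%:E)%E.
  by apply: esum_ge0 => j _; rewrite lee_fin.
case E : (esum _ _) => [B| |] // _; last exact: leey.
by rewrite lee_fin; apply: zsum_le; apply: abssum_esum; rewrite E.
Qed.

Lemma abssum_lin (c d A B : R) (a b : int -> R) : abssum_le a A -> abssum_le b B ->
  abssum_le (fun j => c * a j + d * b j) (`|c| * A + `|d| * B).
Proof.
move=> aA bB N; apply: le_trans
  (lerD (ler_wpM2l (normr_ge0 c) (aA N)) (ler_wpM2l (normr_ge0 d) (bB N))).
rewrite -psum_lin; apply: le_psum => j.
by rewrite -!normrM ler_normD.
Qed.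

Lemma cvge0_le (u : nat -> \bar R) : (forall n, (0 <= u n)%E) ->
  (forall e : R, 0 < e -> \forall n \near \oo, (u n <= e%:E)%E) ->
  u @ \oo --> 0%E.
Proof.
move=> u0 ue; apply/fine_cvgP; split.
  have := ue 1 ltr01; apply: filterS => n un.
  by rewrite ge0_fin_numE //; apply: le_lt_trans un _; exact: ltry.
apply/cvgrPdist_le => e e0; have := ue e e0; apply: filterS => n un.
rewrite sub0r normrN /= ger0_norm ?fine_ge0 // -lee_fin fineK //.
by rewrite ge0_fin_numE //; apply: le_lt_trans un _; exact: ltry.
Qed.

Lemma geometric_small (q B e : R) : 0 < q < 1 -> 0 < e ->
  \forall m \near \oo, B * q ^+ m <= e.
Proof.
move=> /andP[q0 q1] e0.
have c : (fun m => B * q ^+ m) @ \oo --> (B * 0 : R).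
  by apply: cvgMr; apply: cvg_expr; rewrite ger0_norm // ltW.
move/cvgrPdist_le : c => /(_ e e0); apply: filterS => m.
by rewrite mulr0 sub0r normrN; apply: le_trans; exact: ler_norm.
Qed.

Lemma geometric_eq0 (q B c : R) : 0 < q < 1 -> (forall m : nat, `|c| <= B * q ^+ m) -> c = 0.
Proof.
move=> q01 h; apply/eqP; rewrite -normr_le0 leNgt; apply/negP => c0.
have c2 : 0 < `|c| / 2 by rewrite divr_gt0.
have [m _ /(_ m (leqnn m))] := geometric_small B q01 c2.
by move=> /= /(le_trans (h m)); lra.
Qed.

Context (v e f : int -> R) (q C : R).
Hypothesis q01 : 0 < q < 1.
Hypothesis C1 : 1 <= C.
Hypothesis he : solution v e.
Hypothesis hf : solution v f.
Hypothesis w0 : wronskian f e != 0.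
Local Notation rho := (q ^+ 4).
Hypothesis e_le : forall n : int, `|e n| <= C * rho ^ n.
Hypothesis f_le : forall n : int, `|f n| <= C * rho ^ (- n).
Hypothesis eV_le : forall n : int, `|(e n)^-1| <= C * rho ^ (- n).
Hypothesis fV_le : forall n : int, `|(f n)^-1| <= C * rho ^ n.
Hypothesis e_neq0 : forall n, e n != 0.
Hypothesis f_neq0 : forall n, f n != 0.
Hypothesis v_bounded : bounded_seq v.

Let q0 : 0 < q. Proof. by case/andP: q01. Qed.
Let q1 : q < 1. Proof. by case/andP: q01. Qed.
Let qX n : 0 <= q ^+ n. Proof. by rewrite exprn_ge0 // ltW. Qed.

Local Notation D := (8 * C ^+ 6 / `|wronskian f e|).
Local Notation S := ((1 + q) / (1 - q)).

Let D0 : 0 <= D.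
Proof.
have C0 : 0 <= C by exact: le_trans C1.
by rewrite divr_ge0 // mulr_ge0 // exprn_ge0.
Qed.

Let S0 : 0 <= S.
Proof. by apply: divr_ge0; have := q0; have := q1; lra. Qed.

(** The Wronskian of x with e tends to 0 at +oo and that with f tends to 0 at -oo; being constant,
    both are 0. Since e and f are independent, Cramer's rule gives x 0 = x 1 = 0. *)
Lemma bounded_solution_eq0 x : solution v x -> bounded_seq x ->
  forall n, x n = 0.
Proof.
move=> hx [X xX].
have X0 : 0 <= X by apply: le_trans (xX 0).
have C0 : 0 <= C by exact: le_trans C1.
have qz (m : nat) (z : int) : m%:Z <= z -> rho ^ z <= q ^+ m.
  by move=> h; apply: (rho_le q01); lia.
have W1 : x 0 * e 1 - x 1 * e 0 = 0.
  apply: (@geometric_eq0 q (2 * (X * C))) => // m.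
  have -> : x 0 * e 1 - x 1 * e 0 = x m%:Z * e (m%:Z + 1) - x (m%:Z + 1) * e m%:Z.
    by rewrite (wronskian_const hx he m%:Z 0) add0r.
  apply: le_trans (ler_normB _ _) _; rewrite !normrM.
  have T (a b : int) : m%:Z <= b -> `|x a| * `|e b| <= X * C * q ^+ m.
    move=> mb; rewrite -mulrA; apply: ler_pM => //; apply: le_trans (e_le b) _.
    by rewrite ler_wpM2l // qz.
  have := T m%:Z (m%:Z + 1) (ltac:(lia)); have := T (m%:Z + 1) m%:Z (lexx _); lra.
have W2 : x 0 * f 1 - x 1 * f 0 = 0.
  apply: (@geometric_eq0 q (2 * (X * C))) => // m.
  have -> : x 0 * f 1 - x 1 * f 0 =
      x (- m.+1%:Z) * f (- m.+1%:Z + 1) - x (- m.+1%:Z + 1) * f (- m.+1%:Z).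
    by rewrite (wronskian_const hx hf (- m.+1%:Z) 0) add0r.
  apply: le_trans (ler_normB _ _) _; rewrite !normrM.
  have T (a b : int) : m%:Z <= - b -> `|x a| * `|f b| <= X * C * q ^+ m.
    move=> mb; rewrite -mulrA; apply: ler_pM => //; apply: le_trans (f_le b) _.
    by rewrite ler_wpM2l // qz.
  have := T (- m.+1%:Z) (- m.+1%:Z + 1) (ltac:(lia)).
  have := T (- m.+1%:Z + 1) (- m.+1%:Z) (ltac:(lia)); lra.
apply: (@solution_eq0 _ v x 0) => //.
- apply: (mulIf w0); rewrite mul0r /wronskian.
  transitivity (f 0 * (x 0 * e 1 - x 1 * e 0) - e 0 * (x 0 * f 1 - x 1 * f 0)); first by ring.
  by rewrite W1 W2 !mulr0 subr0.
- rewrite add0r; apply: (mulIf w0); rewrite mul0r /wronskian.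
  transitivity (f 1 * (x 0 * e 1 - x 1 * e 0) - e 1 * (x 0 * f 1 - x 1 * f 0)); first by ring.
  by rewrite W1 W2 !mulr0 subr0.
Qed.

Definition green_op x i : R := zsum (fun j => green f e i j * x j).

Lemma kernel_abssum (k : int -> int -> R) (x : int -> R) (X : R) i :
  (forall j, `|k i j| <= D * q ^+ (2 * absz (i - j))) ->
  (forall n, `|x n| <= X) -> abssum_le (fun j => k i j * x j) (D * X * S).
Proof.
move=> kD xX; apply: abssum_esum.
have X0 : 0 <= X by apply: le_trans (xX 0).
apply: (@esum_geometric_bounded _ q q01 (D * X) _ i); first by rewrite mulr_ge0.
move=> j; rewrite normr_ge0 /= normrM mulrAC; apply: ler_pM => //.
apply: le_trans (kD j) _; rewrite ler_wpM2l // ler_wiXn2l ?ltW //.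
by rewrite leq_pmull.
Qed.

Lemma green_abssum (x : int -> R) (X : R) i : (forall n, `|x n| <= X) ->
  abssum_le (fun j => green f e i j * x j) (D * X * S).
Proof. by move=> xX; apply: (@kernel_abssum (green f e)) => // j; exact: green_decay. Qed.

Lemma green_op_bounded (x : int -> R) (X : R) : (forall n, `|x n| <= X) ->
  forall i, `|green_op x i| <= D * X * S.
Proof. by move=> xX i; apply: zsum_le; exact: green_abssum. Qed.

Lemma schrod_green_op x : bounded_seq x ->
  schrod v (green_op x) = x.
Proof.
move=> [X xX]; apply/funext => i; rewrite /schrod /green_op.
have A k := green_abssum k xX.
rewrite -[X in X + _]mul1r -[X in 1 * (X + _)]mul1r -[X in 1 * (_ + X)]mul1r.
rewrite -(zsum_lin 1 1 (A (i + 1)) (A (i - 1))).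
rewrite -(zsum_lin 1 (v i) (abssum_lin 1 1 (A (i + 1)) (A (i - 1))) (A i)).
rewrite (@eq_zsum _ _ (fun j => (j == i)%:R * x j)); last first.
  move=> j /=; rewrite eq_sym -(schrod_green j hf he w0) /schrod; ring.
rewrite (@zsum_finite _ (absz i)) ?psum_delta ?leqnn // => j ij.
by have -> : (j == i) = false; [lia|rewrite mul0r].
Qed.

Lemma schrod_bounded x : bounded_seq x ->
  bounded_seq (schrod v x).
Proof.
move=> [X xX]; have [V vV] := v_bounded; exists (X + X + V * X) => n.
apply: le_trans (ler_normD _ _) _; rewrite lerD //.
  by apply: le_trans (ler_normD _ _) _; rewrite lerD.
by rewrite normrM ler_pM.
Qed.

(** Applying H to the difference of the two sides gives 0 by [schrod_green_op], so the difference is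
    a bounded solution and vanishes. *)
Lemma green_op_schrod x : bounded_seq x ->
  green_op (schrod v x) = x.
Proof.
move=> xb; have [X xX] := xb; have [Y yY] := schrod_bounded xb.
apply/funext => i; apply/eqP; rewrite -subr_eq0; apply/eqP.
have := @bounded_solution_eq0 (fun i => 1 * green_op (schrod v x) i + -1 * x i).
move=> /(_ _ _ i) <-; [by rewrite mul1r mulN1r| |].
  move=> n; have := congr1 (fun g : int -> R => g n) (schrod_green_op (schrod_bounded xb)).
  by rewrite /schrod => h; rewrite /= in h *; lra.
exists (D * Y * S + X) => n; rewrite mul1r mulN1r.
by apply: le_trans (ler_normB _ _) _; rewrite lerD // green_op_bounded.
Qed.

Lemma green_op_lp p x : (1%:E <= p)%E -> in_lp p x -> in_lp p (green_op x).
Proof.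
move=> p1 xlp; have [X xX] := in_lp_bounded p1 xlp.
case: p p1 xlp => [r| |] // p1 xlp; last first.
  apply: (@le_lt_trans _ _ (D * X * S)%:E); last exact: ltry.
  by apply/lpnorm_infP; exact: green_op_bounded.
rewrite lee_fin in p1; move/in_lpP : xlp => /(_ p1) xlp; apply/in_lpP => //.
apply: le_lt_trans (young_geometric q01 p1 D0 xlp _) _.
  move=> i; apply: le_trans (zsum_le_esum _) _; apply: le_esum => j _.
  by rewrite lee_fin normrM ler_wpM2r // green_decay.
by apply: lte_mul_pinfty => //; rewrite lee_fin mulr_ge0 ?powR_ge0.
Qed.

Lemma phi_solution n : solution v (phi e f n).
Proof. exact: solution_lin. Qed.

Lemma psi_solution n : solution v (psi e f n).
Proof. exact: solution_lin. Qed.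

Lemma alpha_beta_small : \forall n \near \oo, `|alpha e f n * beta e f n| <= 2^-1.
Proof.
have h2 : 0 < 2^-1 :> R by rewrite invr_gt0.
have := geometric_small (C * C * (C * C)) q01 h2.
apply: filterS => n h; apply: le_trans h => /=.
have T := norm_mul_le q01 (alpha_le q01 f_le eV_le n) (beta_le q01 e_le fV_le n).
apply: le_trans T _.
have C0 : 0 <= C by exact: le_trans C1.
by rewrite ler_wpM2l ?mulr_ge0 // (rho_le q01) //; lia.
Qed.

(** * Finite sections of large order *)

Section Large.
Variable n : nat.
Hypothesis ab : `|alpha e f n * beta e f n| <= 2^-1.

Let wn0 : wronskian (phi e f n) (psi e f n) != 0.
Proof.
rewrite wronskian_phi_psi mulf_neq0 // subr_eq0; apply: contraTneq ab => <-.
by rewrite normr1 -ltNge invf_lt1 // ltr1n.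
Qed.

Let phi0 : phi e f n (- n.+1%:Z) = 0.
Proof. by rewrite /phi /alpha mul1r mulNr mulfVK // subrr. Qed.

Let psi0 : psi e f n n.+1%:Z = 0.
Proof. by rewrite /psi /beta mul1r mulNr mulfVK // subrr. Qed.

Lemma large_section_unit : fsection (schrod_mx v) n \in unitmx.
Proof.
exact: (fsection_unit (phi_solution n) (psi_solution n) wn0 phi0 psi0).
Qed.

(** The boundary weight is attached to x and the kernel keeps q^(2|i-j|), which is the shape
    [young_geometric] expects. *)
Lemma section_error x i : bounded_seq x ->
  (`|(fsection_inv (schrod_mx v) n x \- green_op x) i|%:E <=
   \esum_(j in [set: int]) (D * q ^+ (2 * absz (i - j)) *
      (q ^+ (n - minn (absz i) (absz j)) * `|x j|))%:E)%E.
Proof.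
move=> [X xX].
pose k i j := section_kernel e f n i j - green f e i j.
have kD j : `|k i j| <= D * q ^+ (2 * absz (i - j) + (n - minn (absz i) (absz j))).
  exact: section_kernel_diff.
have kD' j : `|k i j| <= D * q ^+ (2 * absz (i - j)).
  by apply: le_trans (kD j) _; rewrite ler_wpM2l // ler_wiXn2l ?ltW // leq_addr.
have E : fsection_inv (schrod_mx v) n x i = zsum (fun j => section_kernel e f n i j * x j).
  rewrite (fsection_inv_green (phi_solution n) (psi_solution n) wn0 phi0 psi0).
  rewrite (@zsum_finite _ n); last first.
    by move=> j nj; rewrite /section_kernel [X in _ && X]leqNgt nj andbF mul0r.
  rewrite /section_kernel; case: ifPn => iN.
    by apply: eq_psum => j ->.
  by rewrite /psum big1 // => j _; rewrite mul0r.
have -> : (fsection_inv (schrod_mx v) n x \- green_op x) i = zsum (fun j => k i j * x j).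
  rewrite /= E; apply/eqP; rewrite subr_eq /green_op -[X in X + _]mul1r -[X in _ + X]mul1r.
  rewrite -(zsum_lin 1 1 (kernel_abssum kD' xX) (green_abssum i xX)).
  by apply/eqP; apply: eq_zsum => j; rewrite /k; ring.
apply: le_trans (zsum_le_esum _) _; apply: le_esum => j _.
by rewrite lee_fin normrM mulrA -[_ * _ * q ^+ _]mulrA -exprD ler_wpM2r.
Qed.

End Large.

(** Split at a radius N beyond which x has tail at most d/2: inside, the weight is at most q^(n-N);
    outside, it is at most 1, the exponent being truncated at 0. *)
Lemma lpsum_weighted_cvg (r : R) x : 1 <= r -> (lpsum r x < +oo)%E ->
  forall d : R, 0 < d -> \forall n \near \oo,
    (lpsum r (fun j => (q ^+ (n - absz j) * x j)%R) <= d%:E)%E.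
Proof.
move=> r1 xoo d d0.
have f0 j : 0 <= `|x j| `^ r by exact: powR_ge0.
have d2 : 0 < d / 2 by rewrite divr_gt0.
have [N hN] := esum_tail f0 d2 xoo.
have fin : lpsum r x \is a fin_num by rewrite ge0_fin_numE // lpsum_ge0.
have [M _ hM] := geometric_small (fine (lpsum r x)) q01 d2.
exists (N + M)%N => // n /= NMn.
have qm : fine (lpsum r x) * q ^+ (n - N) <= d / 2 by apply: hM; rewrite /= -(leq_add2l N) subnKC // (leq_trans (leq_addr M N)).
apply: (@le_trans _ _ (\esum_(j in [set: int]) ((q ^+ (n - N))%:E * (`|x j| `^ r)%:E +
    if j \in [set j : int | (N < absz j)%N] then (`|x j| `^ r)%:E else 0))%E).
  apply: le_esum => j _.
  have w1 (m : nat) : (q ^+ m) `^ r <= q ^+ m.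
    by rewrite ge1r_powR // exprn_gt0 //= exprn_ile1 // ltW.
  rewrite normrM [`|q ^+ _|]ger0_norm // powRM //.
  have [jN|Nj] := leqP (absz j) N.
    rewrite ifF; last by apply/negbTE/negP; rewrite inE /= ltnNge jN.
    rewrite adde0 -EFinM lee_fin ler_wpM2r //; apply: le_trans (w1 _) _.
    by rewrite ler_wiXn2l ?ltW // leq_sub2l.
  rewrite ifT; last by rewrite inE.
  rewrite -EFinM -EFinD lee_fin -[leLHS]add0r lerD ?mulr_ge0 //.
  by rewrite ler_piMl // (le_trans (w1 _)) // exprn_ile1 // ltW.
rewrite esumD => [|j _|j _]; last 2 first.
- by rewrite -EFinM lee_fin mulr_ge0.
- by case: ifP; rewrite lee_fin.
rewrite -esum_mkcond.
have -> : d = d / 2 + d / 2 by field.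
rewrite EFinD; apply: leeD => //; apply: le_trans (esumZ_le _ _ _) _ => //.
by rewrite -/(lpsum r x) -(fineK fin) -EFinM lee_fin mulrC.
Qed.

Lemma esum_small (k : int -> R) (A : R) (i : int) : 0 <= A ->
  (forall j, 0 <= k j <= A * q ^+ (2 * absz (i - j))) ->
  (\esum_(j in [set: int]) (k j)%:E <= (A * S)%:E)%E.
Proof.
move=> A0 kA; apply: (@esum_geometric_bounded _ q q01 A _ i) => // j.
case/andP: (kA j) => -> /= /le_trans; apply; rewrite ler_wpM2l //.
by rewrite ler_wiXn2l ?ltW // leq_pmull.
Qed.

Lemma opnorm_inf_le (T : (int -> R) -> int -> R) (B : R) :
  (forall x, (forall j, `|x j| <= 1) -> forall i, `|T x i| <= B) ->
  (opnorm_inf T <= B%:E)%E.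
Proof.
move=> TB; apply: ge_ereal_sup => _ [x /= /lpnorm_infP x1 <-].
by apply/lpnorm_infP; exact: TB.
Qed.

Lemma opnorm_inf_ge0 (T : (int -> R) -> int -> R) : (0 <= opnorm_inf T)%E.
Proof.
apply: (@le_trans _ _ (lpnorm +oo%E (T (fun=> 0)))).
  apply: (@le_trans _ _ `|T (fun=> 0) 0|%:E); first by rewrite lee_fin.
  by apply: ereal_sup_ubound; exists 0.
apply: ereal_sup_ubound; exists (fun=> 0) => //=.
by apply/lpnorm_infP => n; rewrite normr0.
Qed.

Lemma schrod_fsm_applicable p : (1%:E <= p)%E ->
  FSM_applicable p (schrod_mx v) (schrod v).
Proof.
move=> p1; exists green_op; split; [|split].
- move=> x xlp; have xb := in_lp_bounded p1 xlp; split.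
  + exact: green_op_lp.
  + exact: schrod_green_op.
  + exact: green_op_schrod.
- by apply: filterS alpha_beta_small => n; exact: large_section_unit.
case: p p1 => [r| |] // p1; rewrite /fsm_conv.
  move=> x xlp; have xb := in_lp_bounded p1 xlp; rewrite lee_fin in p1.
  move/in_lpP : xlp => /(_ p1) xoo.
  apply: cvge0_le => [n|d d0]; first exact: poweR_ge0.
  set A := ((D * S) `^ r * S).
  have A0 : 0 <= A by rewrite mulr_ge0 ?powR_ge0.
  (* [A] is the constant of the Young inequality; A times this target is at most d^r, and the r-th
     root then gives d. *)
  have dA : 0 < d `^ r / (A + 1) by rewrite divr_gt0 ?powR_gt0 // ltr_wpDl.
  have := lpsum_weighted_cvg p1 xoo dA.
  apply: filterS2 alpha_beta_small => n ab hn.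
  have zoo : (lpsum r (fun j => (q ^+ (n - absz j) * x j)%R) < +oo)%E.
    by apply: le_lt_trans hn _; exact: ltry.
  have Y : (lpsum r (fsection_inv (schrod_mx v) n x \- green_op x)%R <= (d `^ r)%:E)%E.
    apply: le_trans (young_geometric q01 p1 D0 zoo _) _.
      move=> i; apply: le_trans (section_error ab i xb) _; apply: le_esum => j _.
      rewrite lee_fin /= normrM (ger0_norm (qX _)); apply: ler_wpM2l; first by rewrite mulr_ge0.
      rewrite ler_wpM2r //.
      by rewrite ler_wiXn2l ?ltW // leq_sub2l // geq_minr.
    apply: le_trans (lee_wpmul2l _ hn) _; rewrite ?lee_fin //.
    rewrite mulrCA ler_piMr ?powR_ge0 // ler_pdivrMr ?mul1r ?lerDl // ltr_wpDl //.
  have r0 : r != 0 by lra.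
  have dE : d = (d `^ r) `^ r^-1 by rewrite -powRrM divff // powRr1 // ltW.
  rewrite /lpnorm -/(lpsum r _) dE -poweR_EFin.
  apply: gt0_ler_poweR => //; first by rewrite invr_ge0; lra.
    by rewrite in_itv /= lpsum_ge0 leey.
  by rewrite in_itv /= lee_fin powR_ge0 leey.
(* [Pk k] on the left restricts i, on the right j, to [-k,k]. Either way the depth is at least n -
   k, so the error is of order q^(n-k) uniformly on the unit ball. *)
move=> k; split; apply: cvge0_le => [n|d d0]; do ?exact: opnorm_inf_ge0.
  have [M _ hM] := geometric_small (D * S) q01 d0.
  have : \forall n \near \oo, (M + k <= n)%N by exists (M + k)%N.
  apply: filterS2 alpha_beta_small => n ab kn; apply: opnorm_inf_le => x x1 i.
  have xb : bounded_seq x by exists 1.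
  rewrite /Pk; case: ifPn => ik; last by rewrite normr0 ltW.
  rewrite -lee_fin; apply: le_trans (section_error ab i xb) _.
  apply: (@le_trans _ _ ((D * q ^+ (n - k)) * S)%:E).
    apply: (@esum_small _ _ i); first exact: mulr_ge0.
    move=> j; apply/andP; split; first by apply: mulr_ge0; apply: mulr_ge0.
    rewrite [leRHS]mulrAC; apply: ler_wpM2l; first exact: mulr_ge0.
    apply: (@le_trans _ _ (q ^+ (n - minn (absz i) (absz j)) * 1)); first by rewrite ler_wpM2l.
    by rewrite mulr1 ler_wiXn2l ?ltW // leq_sub2l // (leq_trans (geq_minl _ _)).
  by rewrite lee_fin mulrAC; apply: hM; rewrite /= leq_subRL 1?addnC // (leq_trans (leq_addl M k)).
have [M _ hM] := geometric_small (D * S) q01 d0.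
have : \forall n \near \oo, (M + k <= n)%N by exists (M + k)%N.
apply: filterS2 alpha_beta_small => n ab kn; apply: opnorm_inf_le => x x1 i.
have xb : bounded_seq (Pk k x).
  by exists 1 => j; rewrite /Pk; case: ifP => // _; rewrite normr0.
rewrite -lee_fin; apply: le_trans (section_error ab i xb) _.
apply: (@le_trans _ _ ((D * q ^+ (n - k)) * S)%:E).
  apply: (@esum_small _ _ i); first exact: mulr_ge0.
  move=> j; apply/andP; split; first by apply: mulr_ge0; apply: mulr_ge0.
    rewrite [leRHS]mulrAC; apply: ler_wpM2l; first exact: mulr_ge0.
  rewrite /Pk; case: ifPn => jk; last by rewrite normr0 mulr0.
  apply: (@le_trans _ _ (q ^+ (n - minn (absz i) (absz j)) * 1)); first by rewrite ler_wpM2l.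
  by rewrite mulr1 ler_wiXn2l ?ltW // leq_sub2l // (leq_trans (geq_minr _ _)).
by rewrite lee_fin mulrAC; apply: hM; rewrite /= leq_subRL 1?addnC // (leq_trans (leq_addl M k)).
Qed.

End Convergence.

Unset Implicit Arguments.

Theorem theorem1p2 (R : realType) (p : \bar R) (v : int -> R) (K : nat) :
  (1%:E <= p)%E ->
  (0 < K)%N ->
  (forall n : int, v (n + K%:Z) = v n) ->
  [\/ K = 2%N,
      (K <= 8)%N /\ (exists lam : rat,
          forall n : int, v n = 0 \/ v n = ratr lam)
    | forall n : int, v n \is a Num.int] ->
  (FSM_applicable p (schrod_mx v) (schrod v) <->
   2 < `|\tr (monodromy v K)|).
Proof.
move=> p1 K0 vK hyp; split.
  by move=> [Ainv [inv _]]; exact: lp_invertible_trace inv.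
move=> t2.
have [q [C [e [f [[q01 C1 he hf] [w0 [e0 f0]] [e_le f_le] eV_le fV_le]]]]] :=
  floquet_basis K0 vK (dirichlet_period K0 hyp) t2.
have [V [_ vV]] := periodic_bounded K0 vK.
by apply: (schrod_fsm_applicable q01 C1 he hf w0) => //; exists V.
Qed.
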